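(* Let $k,K\in\mathbb N$ with $k\ge 2$, $K\le k$, let $\pi:[k]\to[K]$ be a labelling function, and let $\mathsf o$ be its oddness parameter. Let $C_0\ge 0$ and $\epsilon\in(0,1)$ be arbitrary constants. Consider the following learning problems (in dimension $d$, with effective sample size $n\in\mathbb N$): 1. Tensor PCA testing with $\mathsf o=0$ and $n\le C_0\, d^{\frac k2-\epsilon}$. 2. Tensor PCA estimation with $\mathsf o=0$ and $n\le C_0\, d^{\frac{k+2}{2}-\epsilon}$. 3. Tensor PCA testing or estimation with $\mathsf o\ge 1$ and $n\le C_0\, d^{\frac{k+\mathsf o}{2}-\epsilon}$. Then for any $L\in\mathbb N$ there exist a constant $c_1(k,L,\epsilon,C_0)>0$ depending only on $k,L,\epsilon,C_0$ and a finite constant $C_1(k,L,\epsilon)<\infty$ depending only on $k,L,\epsilon$ such that for all $d\ge C_1(k,L,\epsilon)$, any SQ algorithm that solves Tensor PCA testing with $\mathsf o=0$ and $n\le C_0\, d^{\frac k2-\epsilon}$, or Tensor PCA estimation with $\mathsf o=0$ and $n\le C_0\, d^{\frac{k+2}{2}-\epsilon}$, or Tensor PCA testing or estimation with $\mathsf o\ge 1$ and $n\le C_0\, d^{\frac{k+\mathsf o}{2}-\epsilon}$, must make at least $c_1(k,L,\epsilon,C_0)\cdot d^L$ queries; that is, if an SQ algorithm solves the problem with $n$ samples and $B$ queries, then $B\ge c_1(k,L,\epsilon,C_0)\, d^L$.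
   Context: $[m]=\{1,\dots,m\}$; $\bigotimes^k\mathbb R^d$ is the set of real $d\times\cdots\times d$ tensors of order $k$; $\|\cdot\|$ is the Euclidean norm of the vector of entries. Distributions. For $\boldsymbol V\in\bigotimes^k\mathbb R^d$, $D_{\boldsymbol V}$ is the law of a random tensor $\boldsymbol T\in\bigotimes^k\mathbb R^d$ with independent entries $T_{j_1,\dots,j_k}\sim\mathcal N(V_{j_1,\dots,j_k}/d^{k/2},1)$. $D_0$ is the law of a tensor with i.i.d. $\mathcal N(0,1)$ entries. For a labelling function $\pi:[k]\to[K]$, $$\mathcal D(\pi)=\{D_{\boldsymbol V}:\ \boldsymbol V=\boldsymbol v_{\pi(1)}\otimes\cdots\otimes\boldsymbol v_{\pi(k)},\ \boldsymbol v_1,\dots,\boldsymbol v_K\in\mathbb R^d,\ \|\boldsymbol v_i\|=\sqrt d\ \ \forall i\in[K]\}.$$ Oddness parameter: with $s_i=|\pi^{-1}(i)|$, $\mathsf o=|\{i\in[K]: s_i\text{ is odd}\}|$. VSTAT oracle. For $D\in\{D_0\}\cup\mathcal D(\pi)$ and $n\in\mathbb N$, a $\mathsf{VSTAT}_D(n)$ oracle is any oracle that, given an arbitrary (measurable) function (query) $q:\bigotimes^k\mathbb R^d\to[0,1]$, returns a number $\hat{\mathbb E}_D q(\boldsymbol T)$ with $$|\hat{\mathbb E}_D q(\boldsymbol T)-\mathbb E_D q(\boldsymbol T)|\le\max\left(\frac1n,\sqrt{\frac{\mathbb E_Dq(\boldsymbol T)\,(1-\mathbb E_Dq(\boldsymbol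 T))}{n}}\right);$$ the response is otherwise arbitrary (possibly adversarial). SQ algorithm: an algorithm that knows $\pi$ (and $d,k,n$) and accesses the unknown distribution only through (possibly adaptively chosen) queries to a $\mathsf{VSTAT}_D(n)$ oracle; there is no restriction on its computation. Testing: the algorithm solves the Tensor PCA testing problem with $n$ samples and $B$ queries if, for every $D\in\{D_0\}\cup\mathcal D(\pi)$ (unknown to it) and every $\mathsf{VSTAT}_D(n)$ oracle, it correctly decides whether $D=D_0$ or $D\in\mathcal D(\pi)$ after at most $B$ queries. Estimation: the algorithm solves the Tensor PCA estimation problem with $n$ samples and $B$ queries if, for every $D\in\mathcal D(\pi)$ (unknown to it) and every $\mathsf{VSTAT}_D(n)$ oracle, it returns $\hat{\boldsymbol V}$ with $\|\hat{\boldsymbol V}-\mathbb E_D\boldsymbol T\|\le\frac14$ after at most $B$ queries. *)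

(* Defs.v *)
From HB Require Import structures.
From mathcomp Require Import all_boot all_order all_algebra.
From mathcomp Require Import all_classical all_reals all_analysis.

Set Implicit Arguments.
Unset Strict Implicit.
Unset Printing Implicit Defensive.

Import Order.TTheory GRing.Theory Num.Theory.
Import numFieldNormedType.Exports.

Local Open Scope classical_set_scope.
Local Open Scope ring_scope.

Section Tensors.
Context (R : realType).

Definition tindex (k d : nat) := {ffun 'I_k -> 'I_d}.

(* A tensor is stored as the tuple of its entries, so that it inherits the
   product sigma-algebra that the library puts on tuples. *)
Definition tensor (k d : nat) := #|{: tindex k d}|.-tuple R.

Definition entry k d (T : tensor k d) (j : tindex k d) : R :=
  tnth T (enum_rank j).

Definition tensor_of k d (f : tindex k d -> R) : tensor k d :=
  [tuple f (enum_val i) | i < #|{: tindex k d}|].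

Lemma tensor_ofE k d (f : tindex k d -> R) j : entry (tensor_of f) j = f j.
Proof. by rewrite /entry tnth_mktuple enum_rankK. Qed.

Definition euclid_norm (I : finType) (f : I -> R) : R :=
  Num.sqrt (\sum_i f i ^+ 2).

End Tensors.

Section GaussianLaw.
Context (R : realType).

(* The library puts normal_prob on a copy of R that generates the Borel sets;
   this is the same measure on R itself. *)
Definition normal1 (m : R) : set R -> \bar R := normal_prob m 1.

Let normal1_0 m : normal1 m set0 = 0%E.
Proof. exact: (@measure0 _ _ _ (normal_prob m 1)). Qed.

Let normal1_ge0 m A : (0 <= normal1 m A)%E.
Proof. exact: (@measure_ge0 _ _ _ (normal_prob m 1)). Qed.

Let normal1_sigma_additive m : semi_sigma_additive (normal1 m).
Proof.
exact: (@measure_semi_sigma_additive _ _ _ (normal_prob m 1)).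
Qed.

HB.instance Definition _ m := isMeasure.Build _ _ _ (normal1 m)
  (normal1_0 m) (@normal1_ge0 m) (@normal1_sigma_additive m).

Let normal1_setT m : normal1 m setT = 1%E.
Proof. exact: (@probability_setT _ _ _ (normal_prob m 1)). Qed.

HB.instance Definition _ m :=
  Measure_isProbability.Build _ _ _ (normal1 m) (normal1_setT m).

Definition tcons n (x : R * n.-tuple R) : n.+1.-tuple R := cons_tuple x.1 x.2.

Lemma measurable_tcons n : measurable_fun [set: R * n.-tuple R] (@tcons n).
Proof. exact: (measurable_cons measurable_fst measurable_snd). Qed.

HB.instance Definition _ n :=
  isMeasurableFun.Build _ _ _ _ (@tcons n) (@measurable_tcons n).

Fixpoint normal_tuple_law n : ('I_n -> R) -> probability (n.-tuple R) R :=
  match n with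
  | 0 => fun _ => dirac ([tuple] : 0.-tuple R)
  | n.+1 => fun m =>
      distribution (normal1 (m ord0) \x
                    normal_tuple_law (fun i => m (lift ord0 i)))%E (@tcons n)
  end.

Lemma normal_tuple_lawE n (m : 'I_n -> R) (A : 'I_n -> set R) :
  (forall i, measurable (A i)) ->
  normal_tuple_law m [set x | forall i, A i (tnth x i)] =
  (\prod_(i < n) normal_prob (m i) 1 (A i))%E.
Proof.
elim: n => [|n IH] in m A *.
  move=> _; rewrite big_ord0 /= diracE mem_set//.
  by case.
move=> mA; rewrite big_ord_recl /= -IH//.
rewrite /distribution /pushforward /=.
have -> : @tcons n @^-1` [set x | forall i, A i (tnth x i)] =
    A ord0 `*` [set x | forall i, A (lift ord0 i) (tnth x i)].
  apply/seteqP; split=> [x /= h|x /= [h0 h] i].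
    split; first exact: (h ord0).
    by move=> i; have := h (lift ord0 i); rewrite tnthS.
  by have [j ->|->] := unliftP ord0 i; [rewrite tnthS; exact: h|exact: h0].
rewrite product_measure1E//=.
rewrite (_ : [set x | _] =
  \bigcap_(i in [set: 'I_n]) ((@tnth _ _)^~ i @^-1` A (lift ord0 i))).
  apply: fin_bigcap_measurable => // i _; rewrite -[X in measurable X]setTI.
  exact: measurable_tnth.
by apply/seteqP; split=> x /= h i => [_|]; exact: h.
Qed.

End GaussianLaw.

Section TensorPCA.
Context (R : realType) (k d : nat).
Local Notation tensor := (tensor R k d).

Definition signal_law (V : tensor) : probability tensor R :=
  normal_tuple_law
    (fun i => entry V (enum_val i) / (d%:R `^ (k%:R / 2))).

Definition null_law : probability tensor R := normal_tuple_law (fun=> 0).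

Lemma signal_lawE (V : tensor) (A : tindex k d -> set R) :
  (forall j, measurable (A j)) ->
  signal_law V [set T | forall j, A j (entry T j)] =
  (\prod_j normal_prob (entry V j / (d%:R `^ (k%:R / 2))) 1 (A j))%E.
Proof.
move=> mA; rewrite (reindex _ (onW_bij _ (@enum_val_bij (tindex k d)))) /=.
rewrite -normal_tuple_lawE//; congr (_ _).
apply/seteqP; split=> T /= h i.
  by have := h (enum_val i); rewrite /entry enum_valK.
by have := h (enum_rank i); rewrite enum_rankK.
Qed.

Definition pure_tensor K (pi : 'I_k -> 'I_K) (v : 'I_K -> 'I_d -> R) : tensor :=
  tensor_of (fun j => \prod_(l < k) v (pi l) (j l)).

Definition signal_laws K (pi : 'I_k -> 'I_K) : set (probability tensor R) :=
  [set D | exists v : 'I_K -> 'I_d -> R,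
     (forall i, euclid_norm (v i) = Num.sqrt d%:R) /\
     D = signal_law (pure_tensor pi v)].

Record query := Query {
  query_fun :> tensor -> R;
  measurable_query : measurable_fun [set: tensor] query_fun;
  query_bounded : forall T, 0 <= query_fun T <= 1
}.

Definition query_mean (D : probability tensor R) (q : query) : R :=
  fine ('E_D[q]).

(* Since an oracle here is any fixed response function, an algorithm is only
   asked to cope with oracles that repeat their answer to a repeated query;
   a lower bound in this setting covers history-dependent oracles as well. *)
Definition is_vstat (D : probability tensor R) (n : nat) (O : query -> R) :=
  forall q, `|O q - query_mean D q| <=
    Num.max (n%:R^-1)
      (Num.sqrt (query_mean D q * (1 - query_mean D q) / n%:R)).

(* From the answers received so far, either the next query or the output. *)
Definition sq_algorithm (Out : Type) := seq R -> query + Out.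

(* The result of running A against O, or None if the answers h and B more
   are not enough for A to reach an output. *)
Fixpoint sq_run Out (A : sq_algorithm Out) (O : query -> R) (B : nat)
    (h : seq R) : option Out :=
  match A h, B with
  | inr out, _ => Some out
  | inl q, B'.+1 => sq_run A O B' (rcons h (O q))
  | inl _, 0 => None
  end.

Variant verdict := IsNull | IsSignal.

Definition solves_testing K (pi : 'I_k -> 'I_K) (n B : nat)
    (A : sq_algorithm verdict) : Prop :=
  forall D, ([set null_law] `|` signal_laws pi) D ->
  forall O, is_vstat D n O ->
  exists2 b, sq_run A O B [::] = Some b &
    match b with IsNull => D = null_law | IsSignal => signal_laws pi D end.

Definition mean_tensor (D : probability tensor R) : tensor :=
  tensor_of (fun j => fine ('E_D[fun T : tensor => entry T j])).

Definition solves_estimation K (pi : 'I_k -> 'I_K) (n B : nat)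
    (A : sq_algorithm tensor) : Prop :=
  forall D, signal_laws pi D ->
  forall O, is_vstat D n O ->
  exists2 Vhat, sq_run A O B [::] = Some Vhat &
    euclid_norm (fun j => entry Vhat j - entry (mean_tensor D) j) <= 1 / 4.

End TensorPCA.

Definition oddness k K (pi : 'I_k -> 'I_K) : nat :=
  #|[pred i : 'I_K | odd #|[pred l : 'I_k | pi l == i]|]|.

(* Main.v *)
(* Put the uniform prior on x in {-1,1}^(K * d) and take the v_i to be the rows
   of x, so that D_x = N(u_x, I) with u_x of norm 1.  Each query is answered by
   its mean under one reference law N(b, I): b = 0 for testing and when the
   oddness is positive, b = E_x u_x for estimation with oddness 0.

   By Cauchy-Schwarz against the likelihood ratios, the set A of those x whose
   answer is inadmissible on a given side satisfies
     |A|^2 <= 2 n sum_(x, y in A) (exp <u_x - b, u_y - b> - 1).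
   The exponent depends only on x * y; its Fourier coefficients are nonnegative
   and at most C d^(-e/2) tau^|S|, where the parity of each s_i forces |S| to be
   large and so yields e = k, k + 2 or k + o.  Hence the double sum is at most
   C d^(-e/2) times the squared L2 norm of the noise operator applied to the
   indicator of A, and hypercontractivity from L2 to L2p bounds |A| / 2^(K * d)
   by (C n d^(-e/2))^p = O(d^(- eps p)).  Taking p >= L / eps, fewer than
   c d^L queries leave most x consistent with all the reference answers.
   Testing then fails at once; estimation fails because two typical u_x are
   almost orthogonal. *)
Require Import Defs.
From mathcomp Require Import all_boot all_order all_algebra.
From mathcomp Require Import all_classical all_reals all_analysis.
From mathcomp Require Import measurable_realfun ring lra zify.

Set Implicit Arguments.
Unset Strict Implicit.
Unset Printing Implicit Defensive.

Import Order.TTheory GRing.Theory Num.Theory.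
Import numFieldNormedType.Exports.

Local Open Scope classical_set_scope.
Local Open Scope ring_scope.

(** * Gaussian laws and likelihood ratios *)

Section Density.
Context d (T : measurableType d) (R : realType).
Variables (nu : {finite_measure set T -> \bar R})
  (mu : {sigma_finite_measure set T -> \bar R}) (g : T -> R).
Local Open Scope ereal_scope.
Import Radon_Nikodym_SigmaFinite.

(** The Radon-Nikodym derivative and [g] have the same integral over every measurable set, hence
    agree [mu]-almost everywhere, so the explicit density may replace the abstract one. *)
Lemma ge0_integral_density (h : T -> \bar R) :
  nu `<< mu -> (forall x, (0 <= g x)%R) -> measurable_fun [set: T] g ->
  (forall A, measurable A -> nu A = \int[mu]_(x in A) (g x)%:E) ->
  (forall x, 0 <= h x) -> measurable_fun [set: T] h ->
  \int[nu]_x h x = \int[mu]_x (h x * (g x)%:E).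
Proof.
move=> numu g0 mg nug h0 mh.
rewrite -(change_of_variables numu h0 measurableT mh).
have mf := measurable_int _ (f_integrable numu).
have mEg : measurable_fun setT (EFin \o g) by exact/measurable_EFinP.
apply: ae_eq_integral => //; [exact: emeasurable_funM|exact: emeasurable_funM|].
apply: ae_eqe_mul2l; apply: integral_ae_eq => //; first exact: f_integrable.
by move=> A _ mA; rewrite -(f_integral numu mA) nug.
Qed.

End Density.

Section Gaussian1.
Context (R : realType).
Implicit Types (m b t : R).

(* The density of N(m, 1) with respect to N(b, 1). *)
Definition tilt m b t : R := expR ((m - b) * (t - b) - (m - b) ^+ 2 / 2).

Lemma tilt_ge0 m b t : 0 <= tilt m b t. Proof. exact: expR_ge0. Qed.

Lemma measurable_tilt m b : measurable_fun setT (tilt m b).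
Proof.
apply: measurableT_comp => //; apply: measurable_funB => //.
by apply: measurable_funM => //; apply: measurable_funB.
Qed.

Lemma normal_pdf_tilt m b t :
  normal_pdf b 1 t * tilt m b t = normal_pdf m 1 t.
Proof.
rewrite !normal_pdfE ?oner_eq0// -mulrA; congr (_ * _).
by rewrite /normal_fun /tilt -expRD; congr expR; field.
Qed.

(* normal1 and normal_prob live on copies of R with different displays, hence the
   detour through the pushforward along the identity. *)
Lemma ge0_integral_normal1 m (h : R -> \bar R) :
  (forall x, (0 <= h x)%E) -> measurable_fun [set: R] h ->
  (\int[normal1 m]_x h x =
   \int[lebesgue_measure]_x (h x * (normal_pdf m 1 x)%:E))%E.
Proof.
move=> h0 mh; pose i : measurableTypeR R -> R := idfun.
have mi : measurable_fun [set: measurableTypeR R] i by move=> _ A mA; rewrite setTI.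
transitivity (\int[pushforward (normal_prob m 1) i]_x h x)%E.
  exact: eq_measure_integral.
rewrite ge0_integral_pushforward// preimage_setT.
apply: ge0_integral_density => //.
- exact: normal_prob_dominates.
- by move=> x; exact: normal_pdf_ge0.
- exact: measurable_normal_pdf.
Qed.

Lemma normal1_tilt m b (h : R -> \bar R) :
  (forall x, (0 <= h x)%E) -> measurable_fun [set: R] h ->
  (\int[normal1 m]_x h x = \int[normal1 b]_x (h x * (tilt m b x)%:E))%E.
Proof.
move=> h0 mh; rewrite !ge0_integral_normal1//.
- apply: eq_integral => x _; rewrite -muleA -EFinM mulrC.
  by rewrite normal_pdf_tilt.
- by move=> x; rewrite mule_ge0 ?lee_fin ?tilt_ge0.
- apply: emeasurable_funM => //; apply/measurable_EFinP.
  exact: measurable_tilt.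
Qed.

End Gaussian1.

Section GaussianMean.
Context (R : realType).
Implicit Types (m b t : R).

Lemma integral_tilt m b : (\int[normal1 b]_x (tilt m b x)%:E = 1)%E.
Proof.
transitivity (\int[normal1 m]_x (cst 1 x))%E.
  by rewrite (@normal1_tilt _ m b)//; apply: eq_integral => x _; rewrite mul1e.
by rewrite integral_cst// mul1e; exact: probability_setT.
Qed.

Lemma integrable_id_normal1 b : (normal1 b).-integrable [set: R] (fun t : R => t%:E).
Proof.
apply/integrableP; split; first exact/measurable_EFinP.
(* The two tilts are multiples of [exp x] and [exp (- x)], each of integral 1; the prefactor makes
   their sum dominate the absolute value of [x]. *)
apply: (@le_lt_trans _ _ (\int[normal1 b]_x
    ((expR (`|b| + 1))%:E * ((tilt (b + 1) b x)%:E + (tilt (b - 1) b x)%:E)))%E).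
  apply: ge0_le_integral => //.
  - by apply: measurableT_comp => //; exact/measurable_EFinP.
  - apply/measurable_EFinP; apply: measurable_funM => //.
    by apply: measurable_funD; exact: measurable_tilt.
  move=> x _; rewrite lee_fin mulrDr /tilt -!expRD.
  have h (y : R) : y <= expR y.
    by rewrite (le_trans _ (expR_ge1Dx y))// lerDr.
  have h1 (y z : R) : y <= z -> y <= expR z by move=> yz; rewrite (le_trans yz).
  have b0 : `|b| >= b := ler_norm b.
  have b1 : `|b| >= - b by rewrite -normrN; exact: ler_norm.
  case: (leP 0 x) => x0; [apply: ler_wpDr|apply: ler_wpDl];
      rewrite ?expR_ge0//; apply: h1.
    by rewrite ger0_norm//; lra.
  by rewrite ltr0_norm//; lra.
rewrite ge0_integralZl//.
- rewrite ge0_integralD//.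
  + by rewrite !integral_tilt -!EFinD -EFinM ltry.
  + by move=> x _; rewrite lee_fin tilt_ge0.
  + by apply/measurable_EFinP; exact: measurable_tilt.
  + by move=> x _; rewrite lee_fin tilt_ge0.
  + by apply/measurable_EFinP; exact: measurable_tilt.
- by apply/measurable_EFinP; apply: measurable_funD; exact: measurable_tilt.
- by move=> x _; rewrite -EFinD lee_fin addr_ge0 ?tilt_ge0.
Qed.

Lemma normal1_translate m (h : R -> R) :
  continuous h -> (forall x, 0 <= h x) ->
  (\int[normal1 m]_x (h x)%:E = \int[normal1 0]_x (h (x + m))%:E)%E.
Proof.
move=> ch h0.
have mh : measurable_fun [set: R] h by exact: continuous_measurable_fun.
have mhm : measurable_fun [set: R] (fun x => h (x + m)).
  by apply: measurableT_comp => //; exact: measurable_funD.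
rewrite (@ge0_integral_normal1 _ m (EFin \o h))//; last exact/measurable_EFinP.
rewrite (@ge0_integral_normal1 _ 0 (fun x => (h (x + m))%:E)); last 2 first.
  by move=> x; rewrite lee_fin.
  exact/measurable_EFinP.
pose F (x : R) := x + m.
have dF : F^`()%classic = cst 1.
  by apply/funext => x; rewrite /F derive1E deriveD// derive_id derive_cst addr0.
under eq_integral do rewrite -EFinM.
rewrite (@increasing_ge0_integration_by_substitutionT _ F
  (fun x => h x * normal_pdf m 1 x)).
- apply: eq_integral => x _; rewrite dF !fctE/= mulr1 -EFinM; congr (_ * _)%:E.
  rewrite !normal_pdfE ?oner_eq0// /normal_fun.
  by rewrite /F addrK subr0.
- by move=> x y xy; rewrite /F ltrD2r.
- by rewrite dF => x; exact: cvg_cst.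
- by rewrite dF; exact: is_cvg_cst.
- by rewrite dF; exact: is_cvg_cst.
- by move=> x; apply: derivableD.
- exact: cvg_addrr_Ny.
- exact: cvg_addrr.
- move=> x; apply: cvgM; first exact: ch.
  by apply: continuous_normal_pdf; rewrite oner_eq0.
- by move=> x; rewrite mulr_ge0// normal_pdf_ge0.
Qed.

(* This is 0, but only differences of means matter, so translation invariance
   suffices. *)
Definition normal_mean : R := fine (\int[normal1 (0:R)]_x x%:E).

Lemma integral_id_normal1 m :
  (\int[normal1 m]_x x%:E = (normal_mean + m)%:E)%E.
Proof.
(* Translation is available for nonnegative continuous integrands, so the positive and negative
   parts are moved separately. *)
have cp : continuous (fun x : R => Num.max x 0).
  by move=> x; apply: continuous_max; [exact: cvg_id|exact: cvg_cst].
have cn : continuous (fun x : R => Num.max (- x) 0).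
  move=> x; apply: continuous_max; last exact: cvg_cst.
  by apply: (@cvgN _ R^o); exact: cvg_id.
have ep : (\int[normal1 m]_x (fun x : R => x%:E)^\+ x =
    \int[normal1 0]_x (fun x : R => (x + m)%:E)^\+ x)%E.
  have p0 (x : R) : 0 <= Num.max x 0 by rewrite le_max lexx orbT.
  rewrite (eq_integral (fun x : R => (Num.max x 0)%:E)).
    rewrite (normal1_translate m cp p0).
    by apply: eq_integral => x _; rewrite funeposE EFin_max.
  by move=> x _; rewrite funeposE EFin_max.
have en : (\int[normal1 m]_x (fun x : R => x%:E)^\- x =
    \int[normal1 0]_x (fun x : R => (x + m)%:E)^\- x)%E.
  have n0 (x : R) : 0 <= Num.max (- x) 0 by rewrite le_max lexx orbT.
  rewrite (eq_integral (fun x : R => (Num.max (- x) 0)%:E)).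
    rewrite (normal1_translate m cn n0).
    by apply: eq_integral => x _; rewrite funenegE EFin_max.
  by move=> x _; rewrite funenegE EFin_max.
rewrite integralE ep en -integralE.
under eq_integral do rewrite EFinD.
have ic : (normal1 0).-integrable [set: R] (EFin \o cst m).
  exact: finite_measure_integrable_cst.
rewrite (integralD measurableT (integrable_id_normal1 0) ic).
have -> : (\int[normal1 0]_x (EFin \o cst m) x = m%:E)%E.
  by have := expectation_cst (normal1 0) m; rewrite unlock.
have fin := integrable_fin_num (@measurableT _ _) (integrable_id_normal1 0).
by rewrite /normal_mean EFinD (fineK fin).
Qed.

End GaussianMean.

Lemma integral_probability_cst d (T : measurableType d) (R : realType)
    (P : probability T R) (c : \bar R) : (\int[P]_x cst c x = c)%E.
Proof. by rewrite integral_cst// [X in (_ * X)%E]probability_setT mule1. Qed.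

(** * Product Gaussian laws *)

Section GaussianTuple.
Context (R : realType).

Definition tilts n (m b : 'I_n -> R) (x : n.-tuple R) : R :=
  \prod_(i < n) tilt (m i) (b i) (tnth x i).

Lemma tilts_ge0 n (m b : 'I_n -> R) x : 0 <= tilts m b x.
Proof. by apply: prodr_ge0 => i _; exact: tilt_ge0. Qed.

Lemma measurable_tilts n (m b : 'I_n -> R) :
  measurable_fun [set: n.-tuple R] (tilts m b).
Proof.
apply: measurable_prod => i _; apply: measurableT_comp => //.
- exact: measurable_tilt.
- exact: measurable_tnth.
Qed.

Lemma tilts_tcons n (m b : 'I_n.+1 -> R) (x : R * n.-tuple R) :
  tilts m b (tcons x) = tilt (m ord0) (b ord0) x.1 *
    tilts (fun i => m (lift ord0 i)) (fun i => b (lift ord0 i)) x.2.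
Proof.
rewrite /tilts big_ord_recl; congr (_ * _).
by apply: eq_bigr => i _; rewrite tnthS.
Qed.

Lemma ge0_integral_normal_tuple_law n (m : 'I_n.+1 -> R)
    (h : n.+1.-tuple R -> \bar R) :
  (forall x, (0 <= h x)%E) -> measurable_fun [set: n.+1.-tuple R] h ->
  (\int[normal_tuple_law m]_x h x =
   \int[normal1 (m ord0)]_t
     \int[normal_tuple_law (fun i => m (lift ord0 i))]_y h (tcons (t, y)))%E.
Proof.
move=> h0 mh.
rewrite /= ge0_integral_distribution//.
have mc : measurable_fun [set: R * n.-tuple R] (h \o @tcons R n).
  by apply: measurableT_comp => //; exact: measurable_tcons.
by rewrite (fubini_tonelli1 _ mc) => [|x]; [|exact: h0].
Qed.

Lemma normal_tuple_law_tilts n (m b : 'I_n -> R) (h : n.-tuple R -> \bar R) :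
  (forall x, (0 <= h x)%E) -> measurable_fun [set: n.-tuple R] h ->
  (\int[normal_tuple_law m]_x h x =
   \int[normal_tuple_law b]_x (h x * (tilts m b x)%:E))%E.
Proof.
elim: n => [|n IH] in m b h *; move=> h0 mh.
  rewrite /=; apply: eq_integral => x _.
  by rewrite /tilts big_ord0 mule1.
have mtc : measurable_fun [set: R * n.-tuple R] (h \o @tcons R n).
  by apply: measurableT_comp => //; exact: measurable_tcons.
have mg : measurable_fun [set: n.+1.-tuple R] (fun x => h x * (tilts m b x)%:E)%E.
  apply: emeasurable_funM => //; apply/measurable_EFinP.
  exact: measurable_tilts.
have g0 x : (0 <= h x * (tilts m b x)%:E)%E.
  by rewrite mule_ge0// lee_fin tilts_ge0.
apply: (etrans (ge0_integral_normal_tuple_law m h0 mh)).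
apply: (etrans _ (esym (ge0_integral_normal_tuple_law b g0 mg))).
pose F (t : R) := (\int[normal_tuple_law (fun i => m (lift ord0 i))]_y
  h (tcons (t, y)))%E.
have F0 t : (0 <= F t)%E by apply: integral_ge0 => y _; exact: h0.
have mF : measurable_fun [set: R] F.
  have := @measurable_fun_fubini_tonelli_F _ _ _ _ R
    (normal_tuple_law (fun i => m (lift ord0 i))) _ mtc.
  by apply => x; exact: h0.
apply: (etrans (normal1_tilt (m ord0) (b ord0) F0 mF)).
apply: eq_integral => t _.
have mt : measurable_fun [set: n.-tuple R] (fun y => h (tcons (t, y))).
  by apply: measurableT_comp => //; exact: measurableT_comp.
have ht0 y : (0 <= h (tcons (t, y)))%E by exact: h0.
rewrite /F (IH _ (fun i => b (lift ord0 i)) _ ht0 mt).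
rewrite -ge0_integralZr; last 4 first.
- by [].
- apply: emeasurable_funM => //; apply/measurable_EFinP.
  exact: measurable_tilts.
- by move=> y _; rewrite mule_ge0// lee_fin tilts_ge0.
- by rewrite lee_fin tilt_ge0.
by apply: eq_integral => y _; rewrite tilts_tcons/= EFinM -muleA [X in (_ * X)%E]muleC.
Qed.

Lemma ge0_integral_tnth n (m : 'I_n -> R) i (h : R -> \bar R) :
  (forall x, (0 <= h x)%E) -> measurable_fun [set: R] h ->
  (\int[normal_tuple_law m]_x h (tnth x i) = \int[normal1 (m i)]_t h t)%E.
Proof.
elim: n => [|n IH] in m i *; first by case: i.
move=> h0 mh.
have mhi : measurable_fun [set: n.+1.-tuple R] (fun x => h (tnth x i)).
  by apply: measurableT_comp => //; exact: measurable_tnth.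
apply: (etrans (ge0_integral_normal_tuple_law m (fun x => h0 _) mhi)).
have [j ->|->] := unliftP ord0 i.
  pose c := (\int[normal1 (m (lift ord0 j))]_t h t)%E.
  transitivity (\int[normal1 (m ord0)]_t cst c t)%E.
    apply: eq_integral => t _.
    apply: (etrans _ (IH (fun i => m (lift ord0 i)) j h0 mh)).
    by apply: eq_integral => y _; rewrite tnthS.
  exact: integral_probability_cst.
apply: eq_integral => t _.
transitivity (\int[normal_tuple_law (fun i => m (lift ord0 i))]_y cst (h t) y)%E.
  exact: eq_integral.
exact: integral_probability_cst.
Qed.

Lemma integral_tnth n (m : 'I_n -> R) i :
  (\int[normal_tuple_law m]_x (tnth x i)%:E = (normal_mean R + m i)%:E)%E.
Proof.
pose id_ := fun t : R => t%:E.
have mid : measurable_fun [set: R] id_ by exact/measurable_EFinP.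
have mp : measurable_fun [set: R] (id_^\+)%E by exact: measurable_funepos.
have mn : measurable_fun [set: R] (id_^\-)%E by exact: measurable_funeneg.
have ep := ge0_integral_tnth m i (funepos_ge0 id_) mp.
have en := ge0_integral_tnth m i (funeneg_ge0 id_) mn.
rewrite -integral_id_normal1.
apply: (etrans (integralE _ _ _)); apply: (etrans _ (esym (integralE _ _ _))).
rewrite -[X in (_ = X - _)%E]ep -[X in (_ = _ - X)%E]en.
by congr (_ - _)%E; apply: eq_integral => x _; rewrite ?funeposE ?funenegE.
Qed.

End GaussianTuple.

(** * Covariances and Cauchy-Schwarz against likelihood ratios *)

Section Covariance.
Context d (T : measurableType d) (R : realType) (P : probability T R).

Lemma sqr_Lfun2 (f : T -> R) (c : R) :
  measurable_fun [set: T] f ->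
  (\int[P]_x (f x ^+ 2)%:E <= c%:E)%E -> f \in Lfun P 2%:E.
Proof.
move=> mf fc; rewrite inE; apply/andP; split; rewrite inE//=.
rewrite /finite_norm unlock /Lnorm poweR_lty//.
rewrite (eq_integral (fun x => (f x ^+ 2)%:E)).
  exact: le_lt_trans fc (ltry c).
by move=> x _; rewrite /= powR_mulrn// real_normK// num_real.
Qed.

Lemma covariance_sumr I (s : seq I) (a : I -> R) (f : T -> R) (g : I -> T -> R) :
  f \in Lfun P 2%:E -> (forall i, g i \in Lfun P 2%:E) ->
  (covariance P f (\sum_(i <- s) (a i \o* g i)) =
   (\sum_(i <- s) a i * fine (covariance P f (g i)))%:E)%E.
Proof.
move=> f2 g2.
have Pfin : P setT \is a fin_num := fin_num_measure P _ measurableT.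
have f1 := Lfun_subset12 Pfin f2.
have g1 i := Lfun_subset12 Pfin (g2 i).
have fg1 i := Lfun2_mul_Lfun1 f2 (g2 i).
have ag2 i : a i \o* g i \in Lfun P 2%:E by rewrite Lfun_scale// ler1n.
elim: s => [|i s IH]; first by rewrite !big_nil; exact: covariance_cst_r.
rewrite !big_cons covarianceDr//; last first.
  by apply: rpred_sum => *; rewrite ?lee_fin ?ler1n//; exact: ag2.
have cfin i' : covariance P f (g i') \is a fin_num.
  exact: (covariance_fin_num f1 (g1 i') (fg1 i')).
rewrite IH (covarianceZr (a i) f1 (g1 i) (fg1 i)).
by rewrite -{1}(fineK (cfin i)) -EFinM -EFinD.
Qed.

(** Since [f ^+ 2 <= f] for values in [0, 1], the second moment is at most the mean. This produces
    the variance term of the VSTAT tolerance. *)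
Lemma variance_le01 (f : T -> R) : measurable_fun [set: T] f ->
  (forall x, 0 <= f x <= 1) -> f \in Lfun P 2%:E /\
  fine ('V_P[f]) <= fine ('E_P[f]) * (1 - fine ('E_P[f])).
Proof.
move=> mf f01.
have Pfin : P setT \is a fin_num := fin_num_measure P _ measurableT.
have le1 : (\int[P]_x (f x ^+ 2)%:E <= \int[P]_x (f x)%:E)%E.
  apply: ge0_le_integral => //.
  - by move=> x _; rewrite lee_fin sqr_ge0.
  - by apply/measurable_EFinP; exact: measurable_funX.
  - exact/measurable_EFinP.
  - move=> x _; have /andP[f0 f1] := f01 x.
    by rewrite lee_fin expr2 ler_piMr.
have le2 : (\int[P]_x (f x)%:E <= 1%:E)%E.
  rewrite -[leRHS](integral_probability_cst P); apply: ge0_le_integral => //.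
  - by move=> x _; have /andP[] := f01 x.
  - exact/measurable_EFinP.
  - by move=> x _; have /andP[] := f01 x.
have f2 : f \in Lfun P 2%:E by apply: (@sqr_Lfun2 _ 1) => //; exact: le_trans le2.
have f1 := Lfun_subset12 Pfin f2.
split=> //; rewrite varianceE//.
have e1 := expectation_fin_num f1.
have e2 : ('E_P[f ^+ 2])%E \is a fin_num.
  by apply: expectation_fin_num; rewrite expr2; exact: Lfun2_mul_Lfun1.
rewrite fineB//; last by rewrite fin_numX.
rewrite expe2 fineM// mulrBr mulr1 lerD2r fine_le//.
by rewrite unlock.
Qed.

End Covariance.

Section LikelihoodRatio.
Context (R : realType) (n : nat) (b : 'I_n -> R).
Implicit Types (m : 'I_n -> R) (f : n.-tuple R -> R).
Let P : probability (n.-tuple R) R := normal_tuple_law b.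

(** Completing the square: two likelihood ratios multiply to a constant times the ratio for the mean
    [m1 + m2 - b], so that constant is the expectation of the product. *)
Lemma tilts_mul m1 m2 x : tilts m1 b x * tilts m2 b x =
  expR (\sum_i (m1 i - b i) * (m2 i - b i)) *
  tilts (fun i => m1 i + m2 i - b i) b x.
Proof.
rewrite /tilts -big_split/= expR_sum -big_split/=; apply: eq_bigr => i _.
by rewrite /tilt -!expRD; congr expR; field.
Qed.

Lemma expectation_tilts m : ('E_P[tilts m b] = 1)%E.
Proof.
rewrite unlock -[RHS](integral_probability_cst (normal_tuple_law m)).
apply: (etrans _ (esym (normal_tuple_law_tilts m b _ _))) => //.
by apply: eq_integral => x _; rewrite mul1e.
Qed.

Lemma expectation_tilts_mul m1 m2 : ('E_P[tilts m1 b * tilts m2 b] =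
  (expR (\sum_i (m1 i - b i) * (m2 i - b i)))%:E)%E.
Proof.
have := expectation_tilts (fun i => m1 i + m2 i - b i).
rewrite unlock => e1.
rewrite -[RHS]mule1 -e1; set c := expR _.
pose l := tilts (fun i => m1 i + m2 i - b i) b.
have ml : measurable_fun [set: n.-tuple R] (EFin \o l).
  by apply/measurable_EFinP; exact: measurable_tilts.
have l0 x : [set: n.-tuple R] x -> (0 <= (EFin \o l) x)%E.
  by move=> _; rewrite lee_fin tilts_ge0.
have c0 : (0 <= c%:E)%E by rewrite lee_fin expR_ge0.
transitivity (\int[P]_x (c%:E * (EFin \o l) x))%E; last first.
  exact: (ge0_integralZl P measurableT ml l0 c0).
by apply: eq_integral => x _; rewrite -EFinM -tilts_mul.
Qed.

Lemma tilts_Lfun2 m : tilts m b \in Lfun P 2%:E.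
Proof.
apply: (@sqr_Lfun2 _ _ _ _ _ (expR (\sum_i (m i - b i) * (m i - b i)))).
  exact: measurable_tilts.
rewrite -expectation_tilts_mul unlock le_eqVlt; apply/orP; left; apply/eqP.
by apply: eq_integral => x _; rewrite expr2.
Qed.

Lemma covariance_tilts m1 m2 : (covariance P (tilts m1 b) (tilts m2 b) =
  (expR (\sum_i (m1 i - b i) * (m2 i - b i)) - 1)%:E)%E.
Proof.
have Pfin : P setT \is a fin_num := fin_num_measure P _ measurableT.
rewrite covarianceE.
- by rewrite expectation_tilts_mul !expectation_tilts mule1 EFinB.
- exact: Lfun_subset12 (tilts_Lfun2 _).
- exact: Lfun_subset12 (tilts_Lfun2 _).
- exact: Lfun2_mul_Lfun1 (tilts_Lfun2 _) (tilts_Lfun2 _).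
Qed.

(** Change of measure: weighting [f] by [tilts m b] under the reference gives its mean under N(m,
    I), and the ratio itself has mean 1. *)
Lemma covariance_bounded_tilts m f : measurable_fun [set: n.-tuple R] f ->
  (forall x, 0 <= f x <= 1) ->
  fine (covariance P f (tilts m b)) =
  fine 'E_(normal_tuple_law m)[f] - fine 'E_P[f].
Proof.
move=> mf f01.
have Pfin : P setT \is a fin_num := fin_num_measure P _ measurableT.
have [f2 _] := variance_le01 P mf f01.
have f1 := Lfun_subset12 Pfin f2.
have l1 := Lfun_subset12 Pfin (tilts_Lfun2 m).
have fl1 := Lfun2_mul_Lfun1 f2 (tilts_Lfun2 m).
rewrite (covarianceE f1 l1 fl1) expectation_tilts mule1.
rewrite fineB ?expectation_fin_num//; congr (fine _ - _).
rewrite unlock; apply: esym.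
have f0 x : (0 <= (f x)%:E)%E by have /andP[] := f01 x.
exact: (normal_tuple_law_tilts m b f0 (proj2 (measurable_EFinP _ _) mf)).
Qed.

(** The left side is the covariance of [f] with the combination of likelihood ratios weighted by
    [a]. Cauchy-Schwarz applies, and the variance of the combination expands bilinearly. *)
Lemma sum_mean_shift_le (X : finType) (u : X -> 'I_n -> R) (a : X -> R) f :
  measurable_fun [set: n.-tuple R] f -> (forall x, 0 <= f x <= 1) ->
  \sum_x a x * (fine 'E_(normal_tuple_law (u x))[f] - fine 'E_P[f]) <=
  Num.sqrt (fine 'E_P[f] * (1 - fine 'E_P[f])) *
  Num.sqrt (\sum_x \sum_y a x * a y *
    (expR (\sum_i (u x i - b i) * (u y i - b i)) - 1)).
Proof.
move=> mf f01.
have [f2 vf] := variance_le01 P mf f01.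
pose g x := tilts (u x) b.
have g2 x : g x \in Lfun P 2%:E by exact: tilts_Lfun2.
pose h := \sum_(x <- index_enum X) (a x \o* g x).
have h2 : h \in Lfun P 2%:E.
  apply: rpred_sum => *; rewrite ?lee_fin ?ler1n//.
  by rewrite Lfun_scale// ler1n.
have := covariance_le f2 h2.
have -> : covariance P f h =
    (\sum_x a x * (fine 'E_(normal_tuple_law (u x))[f] - fine 'E_P[f]))%:E.
  rewrite /h (covariance_sumr _ _ f2 g2); congr (_%:E).
  by apply: eq_bigr => x _; rewrite covariance_bounded_tilts.
have -> : ('V_P[h] = (\sum_x \sum_y a x * a y *
    (expR (\sum_i (u x i - b i) * (u y i - b i)) - 1))%:E)%E.
  rewrite /variance {2}/h (covariance_sumr _ _ h2 g2); congr (_%:E).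
  apply: eq_bigr => x _.
  rewrite covarianceC (covariance_sumr _ _ (g2 x) g2)/= mulr_sumr.
  by apply: eq_bigr => y _; rewrite covariance_tilts/= mulrA.
rewrite -(fineK (variance_fin_num f2)) /= -EFinM lee_fin => /le_trans; apply.
by rewrite ler_wpM2r ?sqrtr_ge0// ler_wsqrtr.
Qed.

End LikelihoodRatio.

(** * Hypercontractivity on the cube *)

Section PowerInequalities.
Context (R : realFieldType).
Implicit Types (a b c u v t : R) (p : nat).

Lemma convex_expr p (l m u v : R) : 0 <= l -> 0 <= m -> l + m = 1 ->
  0 <= u -> 0 <= v -> (l * u + m * v) ^+ p <= l * u ^+ p + m * v ^+ p.
Proof.
move=> l0 m0 lm u0 v0; elim: p => [|p IH]; first by rewrite !expr0; lra.
rewrite exprS (le_trans (ler_wpM2l _ IH)) ?addr_ge0 ?mulr_ge0// !exprS.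
(* Both factors have the same sign; times [l * m], this product is the gap in the induction step. *)
have : 0 <= (u - v) * (u ^+ p - v ^+ p).
  have [uv|vu] := leP u v.
    by rewrite mulr_le0// subr_le0// lerXn2r.
  by rewrite mulr_ge0// subr_ge0 ?lerXn2r// ltW.
have -> : m = 1 - l by lra.
set U := u ^+ p; set V := v ^+ p => h.
rewrite -subr_ge0 (_ : _ - _ = l * (1 - l) * ((u - v) * (U - V))); last by ring.
by rewrite (mulr_ge0 (mulr_ge0 _ _) h)//; lra.
Qed.

Lemma tangent_expr p (t u : R) : 0 <= t -> 0 <= u ->
  t ^+ p.+1 + p.+1%:R * t ^+ p * (u - t) <= u ^+ p.+1.
Proof.
move=> t0 u0; elim: p => [|p IH]; first by rewrite !expr1 expr0; lra.
rewrite [leRHS]exprS (le_trans _ (ler_wpM2l u0 IH))// -subr_ge0.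
rewrite (_ : _ - _ = p.+1%:R * t ^+ p * (u - t) ^+ 2); last first.
  by rewrite !exprS -(natr1 p.+1); ring.
by rewrite mulr_ge0 ?sqr_ge0// mulr_ge0// exprn_ge0.
Qed.

Lemma sum_even_terms p (g : nat -> R) : (forall i, odd i -> g i = 0) ->
  \sum_(i < p.*2.+1) g i = \sum_(j < p.+1) g j.*2.
Proof.
move=> g0; elim: p => [|p IH]; first by rewrite !big_ord_recl !big_ord0.
rewrite doubleS big_ord_recr /= big_ord_recr /= IH [RHS]big_ord_recr /=.
by rewrite (g0 p.*2.+1) ?addr0//= odd_double.
Qed.

(** From [j] to [j.+1] the left binomial grows by (2p-2j-1)/(2j+1) times the growth of ['C(p, j)],
    and this factor is at most 2p-1. *)
Lemma bin_double_le p j : ('C(p.*2, j.*2) <= 'C(p, j) * p.*2.-1 ^ j)%N.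
Proof.
elim: j => [|j IH]; first by rewrite !bin0.
have [jp|pj] := ltnP j p; last first.
  by rewrite bin_small// doubleS ltnS ltnW// ltnS leq_double.
have h1 := mul_bin_left p.*2 j.*2.
have h2 := mul_bin_left p.*2 j.*2.+1.
have h3 := mul_bin_left p j.
rewrite doubleS expnS.
set X := 'C(p.*2, j.*2.+2) in h2 *; set Y := 'C(p.*2, j.*2.+1) in h1 h2.
set Z := 'C(p.*2, j.*2) in h1 IH.
set W := 'C(p, j.+1) in h3 *; set U := 'C(p, j) in h3 IH.
set q := p.*2.-1 in IH *.
rewrite -(leq_pmul2l (ltn0Sn j.*2.+1)) h2.
have hY : ((p.*2 - j.*2.+1) * Y <= q * Y)%N.
  by rewrite leq_mul2r /q; apply/orP; right; lia.
apply: (leq_trans hY).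
have hY2 : (Y <= (p.*2 - j.*2) * Z)%N by rewrite -h1 leq_pmull.
have hZ : ((p.*2 - j.*2) * Z <= (p.*2 - j.*2) * (U * q ^ j))%N.
  by rewrite leq_mul2l IH orbT.
apply: (@leq_trans (q * ((p.*2 - j.*2) * (U * q ^ j)))%N).
  by rewrite leq_mul2l (leq_trans hY2 hZ) orbT.
have -> : (p.*2 - j.*2 = 2 * (p - j))%N by lia.
have -> : (j.*2.+2 = 2 * j.+1)%N by lia.
have -> : (q * (2 * (p - j) * (U * q ^ j)) = 2 * ((p - j) * U) * (q * q ^ j))%N by lia.
rewrite -h3.
by apply: eq_leq; lia.
Qed.

(** Bonami's two-point inequality for even exponents. Odd powers of [c] cancel; the even ones are
    compared term by term through [bin_double_le], the hypothesis absorbing the powers of 2p-1. *)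
Lemma two_point p (r a c : R) : r ^+ 2 * (p.*2.-1)%:R <= 1 ->
  ((a + r * c) ^+ p.*2 + (a - r * c) ^+ p.*2) <= 2 * (a ^+ 2 + c ^+ 2) ^+ p.
Proof.
move=> hr.
rewrite exprDn exprBn -big_split /=.
pose g i : R := ((a ^+ (p.*2 - i) * (r * c) ^+ i) *+ 'C(p.*2, i)) * (1 + (-1) ^+ i).
rewrite (eq_bigr (fun i : 'I_p.*2.+1 => g i)); last first.
  move=> i _; rewrite /g mulrDr mulr1; congr (_ + _).
  by rewrite -mulrA -mulrnAr mulrC.
rewrite (@sum_even_terms p g); last first.
  by move=> i oi; rewrite /g -signr_odd oi expr1 subrr mulr0.
rewrite exprDn mulr_sumr; apply: ler_sum => j _; rewrite /g.
rewrite -signr_odd odd_double expr0 [leLHS]mulrC ler_pM2l//.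
rewrite -doubleB -!mul2n !exprM -[leLHS]mulr_natr -[leRHS]mulr_natr -!mulrA.
apply: ler_wpM2l; first by rewrite exprn_ge0// sqr_ge0.
rewrite (exprMn 2) (exprMn j (r ^+ 2)) -mulrA.
set X := c ^+ 2 ^+ j; have X0 : 0 <= X by rewrite exprn_ge0// sqr_ge0.
rewrite mulrCA; apply: ler_wpM2l => //.
have /(ler_wpM2l (exprn_ge0 j (sqr_ge0 r))) : ('C(2 * p, 2 * j))%:R <=
    ('C(p, j) * p.*2.-1 ^ j)%:R :> R.
  by rewrite ler_nat !mul2n bin_double_le.
move=> /le_trans; apply; rewrite natrM natrX mulrCA -exprMn.
by rewrite ler_piMr// exprn_ile1// mulr_ge0 ?sqr_ge0.
Qed.

End PowerInequalities.

(** The triangle inequality in L^p without roots, [A] and [B] bounding the two norms: convexity with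
    weights [A / (A + B)] and [B / (A + B)]. *)
Lemma minkowski_expr (R : realFieldType) (T : finType) p (X Y : T -> R) (A B N : R) :
  (0 < p)%N -> (forall x, 0 <= X x) -> (forall x, 0 <= Y x) ->
  0 <= A -> 0 <= B ->
  \sum_x X x ^+ p <= N * A ^+ p -> \sum_x Y x ^+ p <= N * B ^+ p ->
  \sum_x (X x + Y x) ^+ p <= N * (A + B) ^+ p.
Proof.
move=> p0 X0 Y0 A0 B0 hX hY.
have zero (Z : T -> R) : (forall x, 0 <= Z x) -> \sum_x Z x ^+ p <= N * 0 ^+ p ->
    forall x, Z x = 0.
  move=> Z0 hZ x; rewrite expr0n gtn_eqF//= mulr0 in hZ.
  have : \sum_x Z x ^+ p == 0.
    by rewrite eq_le hZ sumr_ge0// => y _; rewrite exprn_ge0.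
  rewrite psumr_eq0 => [|y _]; last by rewrite exprn_ge0.
  by move=> /allP/(_ x (mem_index_enum _))/=; rewrite expf_eq0 p0 => /eqP.
(* The argument divides by [A] and [B]; a zero bound makes the corresponding function vanish. *)
have [A00|An0] := eqVneq A 0.
  rewrite A00 in hX; rewrite A00 add0r (le_trans _ hY)//.
  by apply: ler_sum => x _; rewrite (zero X)// add0r.
have [B00|Bn0] := eqVneq B 0.
  rewrite B00 in hY; rewrite B00 addr0 (le_trans _ hX)//.
  by apply: ler_sum => x _; rewrite (zero Y)// addr0.
have Ap : 0 < A by rewrite lt_neqAle eq_sym An0.
have Bp : 0 < B by rewrite lt_neqAle eq_sym Bn0.
have AB : A + B != 0 by rewrite gt_eqF// addr_gt0.
set l := A / (A + B); set m := B / (A + B).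
have lm : l + m = 1 by rewrite -mulrDl divff.
have l0 : 0 <= l by rewrite divr_ge0// addr_ge0.
have m0 : 0 <= m by rewrite divr_ge0// addr_ge0.
have step x : (X x + Y x) ^+ p <=
    (A + B) ^+ p * (l / A ^+ p * X x ^+ p + m / B ^+ p * Y x ^+ p).
  have -> : X x + Y x = (A + B) * (l * (X x / A) + m * (Y x / B)).
    by rewrite /l /m; field; rewrite AB An0 Bn0.
  rewrite exprMn ler_wpM2l ?exprn_ge0 ?addr_ge0//.
  rewrite (le_trans (convex_expr p l0 m0 lm _ _)) ?divr_ge0//.
  by rewrite !expr_div_n -!mulrA ![_^-1 * _]mulrC.
apply: (le_trans (ler_sum _ (fun x _ => step x))).
rewrite -mulr_sumr mulrC ler_pM2r ?exprn_gt0 ?addr_gt0//.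
rewrite big_split/= -!mulr_sumr.
have -> : N = l / A ^+ p * (N * A ^+ p) + m / B ^+ p * (N * B ^+ p).
  rewrite [l / _ * _]mulrAC [m / _ * _]mulrAC !mulrA !mulfK ?expf_neq0//.
  by rewrite -mulrDl lm mul1r.
by rewrite lerD// ler_wpM2l// divr_ge0// exprn_ge0.
Qed.

(** * Walsh characters and Bonami's inequality *)

Section Cube.
Context (R : realFieldType) (I : finType).
Local Notation V := {ffun I -> bool}.
Implicit Types (S T x y : V) (i : I).

(** Points of the cube and frequency sets share the type [V]: [true] means the sign -1 in a point
    and membership in a set. Hence [flip] acts on both and [chi] is symmetric. *)
Definition xorv S T : V := [ffun i => S i (+) T i].
Definition unitv i : V := [ffun j => j == i].
Definition zerov : V := [ffun=> false].
Definition flip i S : V := xorv S (unitv i).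
Definition weight S : nat := \sum_i S i.
Definition chi S x : R := \prod_i (-1) ^+ (S i && x i).

Lemma flipE i S j : flip i S j = S j (+) (j == i).
Proof. by rewrite !ffunE. Qed.

Lemma flipK i : involutive (flip i).
Proof. by move=> S; apply/ffunP => j; rewrite !flipE addbK. Qed.

Lemma sum_flip i (f : V -> R) : \sum_x f (flip i x) = \sum_x f x.
Proof. by rewrite [RHS](reindex_inj (inv_inj (flipK i))). Qed.

Lemma chiC S x : chi S x = chi x S.
Proof. by apply: eq_bigr => i _; rewrite andbC. Qed.

Lemma chi_flip i S x : chi (flip i S) x = (-1) ^+ (x i) * chi S x.
Proof.
rewrite /chi (bigD1 i)//= [in RHS](bigD1 i)//= mulrA; congr (_ * _).
  rewrite flipE eqxx addbT.
  by case: (S i); case: (x i); rewrite ?expr0 ?expr1 ?mulr1 ?mul1r ?mulrNN ?mulr1.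
by apply: eq_bigr => j /negbTE ji; rewrite flipE ji addbF.
Qed.

Lemma chi0 x : chi zerov x = 1.
Proof. by rewrite /chi big1// => i _; rewrite ffunE. Qed.

Lemma sum_chi S : \sum_x chi S x = #|{: V}|%:R * (S == zerov)%:R.
Proof.
have [->|Sn0] := eqVneq S zerov.
  by rewrite mulr1 (eq_bigr (fun=> 1)) ?sumr_const// => x _; rewrite chi0.
have [i Si] : exists i, S i.
  apply/existsP; apply: contraR Sn0 => /existsPn S0.
  by apply/eqP/ffunP => i; rewrite ffunE; apply/negbTE/S0.
rewrite mulr0; suff : \sum_x chi S x = - \sum_x chi S x by lra.
rewrite -{1}(sum_flip i) -sumrN; apply: eq_bigr => x _.
by rewrite ![chi S _]chiC chi_flip Si expr1 mulN1r.
Qed.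

Lemma weight_flip i S : (weight (flip i S) + S i = weight S + ~~ S i)%N.
Proof.
rewrite /weight (bigD1 i)//= [in RHS](bigD1 i)//= flipE eqxx addbT.
under eq_bigr => j ji do rewrite flipE (negbTE ji) addbF.
by case: (S i); rewrite ?addn0 ?addn1 ?add0n ?add1n.
Qed.

Lemma weight_le_flip i S : (weight S <= (weight (flip i S)).+1)%N.
Proof.
rewrite -addn1 (leq_trans (leq_addr (~~ S i) _))// -weight_flip leq_add2l.
exact: leq_b1.
Qed.

Definition supported S (s : seq I) := [forall i, S i ==> (i \in s)].

Lemma weight0_eq S : (weight S == 0)%N = (S == zerov).
Proof.
apply/idP/eqP => [|->].
  rewrite /weight sum_nat_eq0 => /forallP h; apply/ffunP => i; rewrite ffunE.
  by have := h i; rewrite /= eqb0 => /negbTE.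
by rewrite /weight big1// => i _; rewrite ffunE.
Qed.

(* The value at x of the noise operator with parameter rho applied to the
   function with Fourier coefficients a, truncated to characters on s. *)
Definition noisy (rho : R) (a : V -> R) (s : seq I) x : R :=
  \sum_(S | supported S s) a S * rho ^+ weight S * chi S x.

Lemma supported_nil S : supported S [::] = (S == zerov).
Proof.
apply/forallP/eqP => [h|-> i]; last by rewrite ffunE.
by apply/ffunP => i; rewrite ffunE; have := h i; case: (S i).
Qed.

Lemma supported_consN i s S : i \notin s ->
  supported S (i :: s) && ~~ S i = supported S s.
Proof.
move=> si; apply/andP/forallP => [[/forallP h Si] j|h].
  have := h j; rewrite inE; have [->|//] := eqVneq j i.
  by rewrite (negbTE Si).
split; last by have := h i; rewrite (negbTE si) implybF.
by apply/forallP => j; rewrite inE; apply/implyP => Sj; rewrite (implyP (h j))// orbT.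
Qed.

Lemma sum_supported_cons i s (f : V -> R) : i \notin s ->
  \sum_(S | supported S (i :: s)) f S =
  \sum_(S | supported S s) f S + \sum_(S | supported S s) f (flip i S).
Proof.
move=> si; rewrite (bigID (fun S : V => S i))/= addrC; congr (_ + _).
  by apply: eq_bigl => S; exact: supported_consN.
rewrite (reindex_inj (inv_inj (flipK i))); apply: eq_bigl => S.
rewrite -(supported_consN S si) flipE eqxx addbT; case Si : (S i) => //=.
  by rewrite !andbF.
rewrite !andbT; apply/forallP/forallP => h j; have := h j; rewrite ?flipE inE;
  by have [->|_] := eqVneq j i; rewrite ?addbF// ?implybT.
Qed.

(** The frequencies are split by whether they contain [i]. Neither remaining sum depends on [x i],
    by [noisy_flip]. *)
Lemma noisy_cons rho a i s x : i \notin s ->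
  noisy rho a (i :: s) x =
  noisy rho a s x + rho * ((-1) ^+ (x i) * noisy rho (a \o flip i) s x).
Proof.
move=> si; rewrite {1}/noisy sum_supported_cons//; congr (_ + _).
rewrite /noisy !mulr_sumr; apply: eq_bigr => S.
rewrite -(supported_consN S si) => /andP[_ /negbTE Si].
have -> : weight (flip i S) = (weight S).+1.
  by have := weight_flip i S; rewrite Si addn0 addn1.
by rewrite chi_flip exprS /=; ring.
Qed.

Lemma noisy_flip rho a i s x : i \notin s ->
  noisy rho a s (flip i x) = noisy rho a s x.
Proof.
move=> si; apply: eq_bigr => S /forallP sS.
rewrite chiC chi_flip chiC.
have -> : S i = false by have := sS i; rewrite (negbTE si) implybF => /negbTE.
by rewrite mul1r.
Qed.

(** Induction on the coordinates: the two-point inequality handles coordinate [i], and Minkowski's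
    inequality with exponent [p], applied to the squares of the two remaining parts, merges their
    induction hypotheses. *)
Lemma hypercontractive_seq p (rho : R) (a : V -> R) (s : seq I) :
  (0 < p)%N -> rho ^+ 2 * (p.*2.-1)%:R <= 1 -> uniq s ->
  \sum_x noisy rho a s x ^+ p.*2 <=
  #|{: V}|%:R * (\sum_(S | supported S s) a S ^+ 2) ^+ p.
Proof.
move=> p0 hr; elim: s a => [|i s IH] a /=.
  move=> _; have e (f : V -> R) : \sum_(S | supported S [::]) f S = f zerov.
    by rewrite (eq_bigl (pred1 zerov)) ?big_pred1_eq// => S; exact: supported_nil.
  rewrite e (eq_bigr (fun=> (a zerov ^+ 2) ^+ p)).
    by rewrite sumr_const -[leLHS]mulr_natl.
  move=> x _; rewrite /noisy e chi0 mulr1.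
  have /eqP -> : weight zerov == 0%N by rewrite weight0_eq.
  by rewrite mulr1 -mul2n exprM.
move=> /andP[si us].
pose A := \sum_(S | supported S s) a S ^+ 2.
pose B := \sum_(S | supported S s) (a \o flip i) S ^+ 2.
have -> : \sum_(S | supported S (i :: s)) a S ^+ 2 = A + B.
  by rewrite sum_supported_cons.
pose F0 := noisy rho a s; pose F1 := noisy rho (a \o flip i) s.
have hF x : noisy rho a (i :: s) x ^+ p.*2 + noisy rho a (i :: s) (flip i x) ^+ p.*2
    <= 2 * (F0 x ^+ 2 + F1 x ^+ 2) ^+ p.
  rewrite !noisy_cons// !noisy_flip// flipE eqxx addbT.
  have -> : (-1) ^+ (~~ x i) = - (-1) ^+ (x i) :> R.
    by case: (x i); rewrite ?expr0 ?expr1 ?opprK.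
  rewrite !mulNr mulrN (le_trans (two_point _ _ hr))//.
  by rewrite exprMn sqrr_sign mul1r.
(* Doubling the sum pairs each [x] with [flip i x]. *)
rewrite -(ler_pM2l (ltr0Sn R 1)) mulr_natl mulr2n -{2}(sum_flip i) -big_split/=.
apply: (le_trans (ler_sum _ (fun x _ => hF x))); rewrite -mulr_sumr ler_pM2l//.
apply: minkowski_expr => //.
- by move=> x; exact: sqr_ge0.
- by move=> x; exact: sqr_ge0.
- by apply: sumr_ge0 => S _; exact: sqr_ge0.
- by apply: sumr_ge0 => S _; exact: sqr_ge0.
- by have := IH a us; rewrite -mul2n; under eq_bigr do rewrite exprM.
- by have := IH (a \o flip i) us; rewrite -mul2n; under eq_bigr do rewrite exprM.
Qed.

End Cube.

Section Level.
Context (R : realFieldType) (I : finType).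
Local Notation V := {ffun I -> bool}.
Implicit Types (S x : V) (A : {pred V}).

Definition char_sum A S : R := \sum_(x in A) chi R S x.

(** The weighted mass [W] is the sum over [A] of a noisy function [G]. Hypercontractivity bounds the
    sum of the 2p-th powers of [G] by the cube size times [W ^+ p]; Jensen on [A] bounds it below by
    |A| (W / |A|)^(2p). Cancelling [W ^+ p] concludes. *)
Lemma level_inequality p (rho : R) A :
  (0 < p)%N -> rho ^+ 2 * (p.*2.-1)%:R <= 1 ->
  (\sum_S (rho ^+ 2) ^+ weight S * char_sum A S ^+ 2) ^+ p <=
  #|{: V}|%:R * #|A|%:R ^+ p.*2.-1.
Proof.
move=> p0 hr; set W := \sum_S _.
have W0 : 0 <= W.
  by apply: sumr_ge0 => S _; rewrite mulr_ge0 ?sqr_ge0// exprn_ge0 ?sqr_ge0.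
have [->|Wn0] := eqVneq W 0.
  by rewrite expr0n gtn_eqF//= mulr_ge0 ?exprn_ge0.
(* One power of [rho] per coordinate sits in [a] and one in [noisy]: thus the squares of [a] sum to
   [W], and so does [G] over [A]. *)
pose a S := rho ^+ weight S * char_sum A S.
pose G := noisy rho a (enum I).
have supT S : supported S (enum I) by apply/forallP => i; rewrite mem_enum implybT.
have GE x : G x = \sum_S (rho ^+ 2) ^+ weight S * char_sum A S * chi R S x.
  rewrite /G /noisy; apply: eq_big => [S|S _]; first by rewrite supT.
  by rewrite /a -exprM mul2n -addnn exprD; ring.
have hyp : \sum_x G x ^+ p.*2 <= #|{: V}|%:R * W ^+ p.
  have := hypercontractive_seq a p0 hr (enum_uniq I).
  have -> // : \sum_(S | supported S (enum I)) a S ^+ 2 = W.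
  apply: eq_big => [S|S _]; first by rewrite supT.
  by rewrite /a [LHS]exprMn exprAC.
have AG : \sum_(x in A) G x = W.
  under eq_bigr do rewrite GE; rewrite exchange_big; apply: eq_bigr => S _.
  by rewrite -mulr_sumr -mulrA -expr2.
have A0 : 0 < #|A|%:R :> R.
  rewrite ltr0n lt0n; apply: contra_neq Wn0 => A0.
  by rewrite -AG big_pred0// => x; exact: (card0_eq A0).
set t := W / #|A|%:R.
have t0 : 0 <= t by rewrite divr_ge0.
have e2 : (p.*2 = (p.*2.-1).+1)%N by lia.
have jensen : #|A|%:R * t ^+ p.*2 <= \sum_(x in A) G x ^+ p.*2.
  (* Jensen through the tangent at the mean [t], whose linear terms cancel over [A]. *)
  have tan x : t ^+ p.*2 + p.*2%:R * t ^+ p.*2.-1 * (G x - t) <= G x ^+ p.*2.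
    have -> : G x ^+ p.*2 = `|G x| ^+ p.*2.
      by rewrite -mul2n !exprM real_normK// num_real.
    rewrite e2; apply: le_trans (tangent_expr _ t0 (normr_ge0 (G x))).
    by rewrite lerD2l ler_wpM2l ?mulr_ge0 ?exprn_ge0// lerD2r ler_norm.
  apply: le_trans (ler_sum _ (fun x _ => tan x)).
  rewrite big_split/= sumr_const -[X in _ <= X + _]mulr_natl -mulr_sumr.
  have -> : \sum_(x in A) (G x - t) = 0; last by rewrite mulr0 addr0.
  rewrite big_split/= AG sumr_const -[X in W + X]mulr_natl mulrN /t mulrC.
  by rewrite divfK ?gt_eqF// subrr.
have hA : \sum_(x in A) G x ^+ p.*2 <= \sum_x G x ^+ p.*2.
  rewrite [leRHS](bigID (mem A))/= lerDl sumr_ge0// => x _.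
  by rewrite -mul2n exprM exprn_ge0 ?sqr_ge0.
have := le_trans jensen (le_trans hA hyp).
have -> : #|A|%:R * t ^+ p.*2 = W ^+ p / #|A|%:R ^+ p.*2.-1 * W ^+ p.
  rewrite /t expr_div_n {2}e2 exprS -addnn exprD; field.
  by rewrite expf_neq0 gt_eqF.
have Wp : 0 < W ^+ p by rewrite exprn_gt0// lt_neqAle eq_sym Wn0.
by rewrite ler_pM2r// ler_pdivrMr// exprn_gt0.
Qed.

End Level.

(** * Fourier coefficients of the overlap *)

Section Kernel.
Context (R : realFieldType) (I : finType).
Local Notation V := {ffun I -> bool}.
Implicit Types (S x y : V) (kappa : V -> R).

(** Since [chi S x * chi S y] is the character at [xorv x y], these are the kernels depending on
    [xorv x y] alone, with Fourier coefficients [kappa]. *)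
Definition kernel_of kappa x y : R := \sum_S kappa S * chi R S x * chi R S y.

Lemma quadratic_kernel kappa (A : {pred V}) :
  \sum_(x in A) \sum_(y in A) kernel_of kappa x y =
  \sum_S kappa S * char_sum R A S ^+ 2.
Proof.
under eq_bigr do rewrite exchange_big /=.
rewrite exchange_big; apply: eq_bigr => S _.
under eq_bigr do rewrite -mulr_sumr -mulrA.
by rewrite -mulr_sumr -mulr_suml expr2.
Qed.

Lemma sum_kernel kappa x :
  \sum_y kernel_of kappa x y = #|{: V}|%:R * kappa (zerov I).
Proof.
rewrite exchange_big /= (bigD1 (zerov I))//= [X in _ + X]big1 => [|S S0].
  by rewrite -mulr_sumr sum_chi eqxx chi0 !mulr1 addr0 mulrC.
by rewrite -mulr_sumr sum_chi (negbTE S0) !mulr0.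
Qed.

End Kernel.

Section BlockKernel.
Context (R : realFieldType) (K d : nat).
Local Notation I := ('I_K * 'I_d)%type.
Local Notation V := {ffun I -> bool}.
Implicit Types (S x y : V) (t : seq 'I_K) (i : 'I_K).
Variable r : R.
Hypotheses (r0 : 0 <= r) (rd : r ^+ 2 * d%:R = 1).

Definition block_mean i x y : R :=
  r ^+ 2 * \sum_(j < d) (-1) ^+ x (i, j) * (-1) ^+ y (i, j).

(* Fourier coefficients of the product of the block means along t. *)
Fixpoint block_coef t : V -> R :=
  match t with
  | [::] => fun S => (S == zerov I)%:R
  | i :: t' => fun S => r ^+ 2 * \sum_(j < d) block_coef t' (flip (i, j) S)
  end.

Lemma kernel_block_coef t x y :
  kernel_of (block_coef t) x y = \prod_(i <- t) block_mean i x y.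
Proof.
elim: t => [|i t IH].
  rewrite big_nil /kernel_of (bigD1 (zerov I))//= eqxx !chi0 !mulr1 big1 ?addr0//.
  by move=> S /negbTE S0; rewrite S0 !mul0r.
rewrite big_cons -IH /kernel_of /block_mean.
transitivity (r ^+ 2 * \sum_(j < d) \sum_S
    block_coef t (flip (i, j) S) * chi R S x * chi R S y).
  rewrite exchange_big mulr_sumr; apply: eq_bigr => S _ /=.
  by rewrite -!mulr_suml !mulrA.
rewrite -mulrA mulr_suml; congr (_ * _); apply: eq_bigr => j _.
rewrite -(sum_flip (i, j)) mulr_sumr; apply: eq_bigr => S _.
by rewrite flipK !chi_flip; ring.
Qed.

Lemma block_coef_ge0 t S : 0 <= block_coef t S.
Proof.
elim: t S => [|i t IH] S /=; first by case: eqP.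
by rewrite mulr_ge0 ?sqr_ge0// sumr_ge0.
Qed.

Definition block_weight i S : nat := \sum_(j < d) S (i, j).

Lemma sum_block_weight S : weight S = (\sum_i block_weight i S)%N.
Proof.
rewrite /weight /block_weight pair_big /=.
by apply: eq_bigr => -[].
Qed.

Lemma block_weight_flip i l j S :
  odd (block_weight i (flip (l, j) S)) = odd (block_weight i S) (+) (l == i).
Proof.
have [<-|li] := eqVneq l i; last first.
  rewrite addbF /block_weight; congr odd; apply: eq_bigr => j' _.
  by rewrite flipE xpair_eqE eq_sym (negbTE li) addbF.
rewrite /block_weight (bigD1 j)//= [in RHS](bigD1 j)//= flipE eqxx addbT.
rewrite (eq_bigr (fun j' => nat_of_bool (S (l, j')))) => [|j' /negbTE j'j]; last first.
  by rewrite flipE xpair_eqE j'j andbF addbF.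
by rewrite !oddD !oddb; case: (S (l, j)) => /=; rewrite ?addbT ?negbK.
Qed.

(** Up to a power of [r], [block_coef t S] counts the walks from the empty set to [S] that flip, for
    each letter [i] of [t], one position of block [i]. The length bounds the weight, and the letters
    fix each block's parity. *)
Lemma block_coef_support t S : block_coef t S != 0 ->
  (weight S <= size t)%N /\ forall i, odd (block_weight i S) = odd (count_mem i t).
Proof.
elim: t S => [|l t IH] S /=.
  have [->|] := eqVneq S (zerov I); last by rewrite eqxx.
  move=> _; split; first by rewrite leqn0 weight0_eq.
  by move=> i; rewrite /block_weight big1// => j _; rewrite ffunE.
rewrite mulf_eq0 negb_or => /andP[_].
have [[j hj] _|h] := pselect (exists j, block_coef t (flip (l, j) S) != 0); last first.
  rewrite big1 ?eqxx// => j _; apply/eqP; apply: contra_notT h => hj.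
  by exists j.
have [wS oS] := IH _ hj; split.
  exact: leq_trans (weight_le_flip (l, j) S) _.
move=> i; have := oS i; rewrite block_weight_flip oddD => <-.
by rewrite oddb; case: (odd _); case: (l == i).
Qed.

Lemma block_coef_le t S :
  block_coef t S <= ((size t).+1`!)%:R * r ^+ (size t + weight S).
Proof.
elim: t S => [|i t IH] S.
  rewrite /=; have [->|_] := eqVneq S (zerov I); last first.
    by rewrite mulr0n mulr_ge0 ?exprn_ge0.
  have /eqP -> : weight (zerov I) == 0%N by rewrite weight0_eq.
  by rewrite expr0 mulr1.
have [->|n0] := eqVneq (block_coef (i :: t) S) 0.
  by rewrite mulr_ge0 ?exprn_ge0.
have [/= wS _] := block_coef_support n0.
set C : R := ((size t).+1`!)%:R.
have C0 : 0 <= C by [].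
set e := (size t + weight S)%N.
(* Flipping a position of [S] lowers the weight and gives exactly [r ^+ e.+1]; flipping any other
   position raises it and leaves an extra [r ^+ 2]. *)
have step j : r ^+ 2 * block_coef t (flip (i, j) S) <=
    C * r ^+ e.+1 * ((S (i, j))%:R + r ^+ 2).
  apply: le_trans (ler_wpM2l (sqr_ge0 r) (IH _)) _.
  have := weight_flip (i, j) S; case: (S (i, j)) => /= hw.
    have hw' : weight S = (weight (flip (i, j) S)).+1.
      by rewrite -[LHS]addn0 -hw addn1.
    rewrite /e hw' addnS -/C; set N := (size t + _)%N.
    have -> : r ^+ N.+2 = r ^+ 2 * r ^+ N by rewrite -exprD.
    by rewrite mulrDr mulr1 mulrCA ler_wpDr// !mulr_ge0 ?sqr_ge0 ?exprn_ge0.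
  have -> : weight (flip (i, j) S) = (weight S).+1.
    by rewrite -[LHS]addn0 hw addn1.
  rewrite addnS -/e.
  by rewrite add0r mulrC.
(* At most [(size t).+1] positions are of the first kind, and the others add at most
   [r ^+ 2 * d = 1]: the total [(size t).+2] extends the factorial. *)
rewrite /= mulr_sumr; apply: le_trans (ler_sum _ (fun j _ => step j)) _.
rewrite -mulr_sumr big_split/= sumr_const card_ord -[X in _ + X]mulr_natr rd -natr_sum.
rewrite factS natrM -/e -/C mulrC mulrA ler_wpM2r ?exprn_ge0//.
rewrite ler_wpM2r// natr1 ler_nat ltnS (leq_trans _ wS)//.
by rewrite sum_block_weight (bigD1 i)//= leq_addr.
Qed.

(** A letter averages over [d] flips, each changing the weight by one. Unlike the factorial bound,
    the cost [tau^-1] per letter is geometric and can be summed in the exponential series. *)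
Lemma block_coef_cons_le (tau A : R) i t : 0 < tau -> tau <= 1 ->
  (forall S, block_coef t S <= A * tau ^+ weight S) ->
  forall S, block_coef (i :: t) S <= A * tau^-1 * tau ^+ weight S.
Proof.
move=> t0 t1 h S.
have A0 : 0 <= A.
  have := le_trans (block_coef_ge0 t (zerov I)) (h (zerov I)).
  have /eqP -> : weight (zerov I) == 0%N by rewrite weight0_eq.
  by rewrite mulr1.
have step j : block_coef t (flip (i, j) S) <= A * tau^-1 * tau ^+ weight S.
  apply: (le_trans (h _)); rewrite -mulrA ler_wpM2l//.
  rewrite ler_pdivlMl// -exprS.
  by rewrite ler_wiXn2l ?(ltW t0)// weight_le_flip.
rewrite /=; apply: (le_trans (ler_wpM2l (sqr_ge0 r) (ler_sum _ (fun j _ => step j)))).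
by rewrite sumr_const card_ord -[X in _ * X]mulr_natl mulrA rd mul1r.
Qed.

Lemma block_coef_cat_le (tau A : R) t1 t : 0 < tau -> tau <= 1 ->
  (forall S, block_coef t S <= A * tau ^+ weight S) ->
  forall S, block_coef (t1 ++ t) S <= A * tau^-1 ^+ size t1 * tau ^+ weight S.
Proof.
move=> t0 t1' h; elim: t1 => [|i t1 IH] S; first by rewrite expr0 mulr1.
rewrite (le_trans (block_coef_cons_le i t0 t1' IH S))//.
by rewrite exprSr mulrA.
Qed.

End BlockKernel.

(** * The exponential of the centred overlap *)

Lemma cvg_sumr (R : realType) I (s : seq I) (P : pred I) (u : I -> nat -> R)
    (l : I -> R) :
  (forall i, u i n @[n --> \oo] --> l i) ->
  (\sum_(i <- s | P i) u i n) @[n --> \oo] --> \sum_(i <- s | P i) l i.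
Proof.
move=> ul; elim: s => [|i s IH].
  by under eq_fun do rewrite big_nil; rewrite big_nil; exact: cvg_cst.
under eq_fun do rewrite big_cons; rewrite big_cons; case: (P i) => //.
by apply: cvgD.
Qed.

Lemma series_exp_coeff_le (R : realType) (x : R) n : 0 <= x ->
  series (exp_coeff x) n <= expR x.
Proof.
move=> x0; apply: nondecreasing_cvgn_le; last exact: is_cvg_series_exp_coeff.
by apply: nondecreasing_series => k _ _; exact: exp_coeff_ge0.
Qed.

Section ExpKernel.
Context (R : realType) (K d : nat) (r : R).
Hypothesis rd : r ^+ 2 * d%:R = 1.
Local Notation V := {ffun 'I_K * 'I_d -> bool}.
Local Notation coef := (@block_coef R K d r).
Variables (w : seq 'I_K) (A : {pred V}) (c tau B : R).
Hypotheses (tau0 : 0 < tau) (tau1 : tau <= 1) (c0 : 0 <= c) (B0 : 0 <= B).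
Hypothesis coef1 : forall S, coef w S - c * (S == zerov _)%:R <= B * tau ^+ weight S.
Hypothesis coef2 : forall S, coef (w ++ w) S <= B * tau ^+ weight S.

Definition overlap (x y : V) : R := \prod_(i <- w) block_mean r i x y.

Let W := \sum_S tau ^+ weight S * char_sum R A S ^+ 2.

Let W0 : 0 <= W.
Proof.
by apply: sumr_ge0 => S _; rewrite mulr_ge0 ?sqr_ge0// exprn_ge0// ltW.
Qed.

Let quad (F : V -> V -> R) := \sum_(x in A) \sum_(y in A) F x y.

Let quad_coef_le (kappa : V -> R) (b : R) :
  (forall S, kappa S <= b * tau ^+ weight S) ->
  quad (kernel_of kappa) <= b * W.
Proof.
move=> h; rewrite /quad quadratic_kernel /W mulr_sumr; apply: ler_sum => S _.
by rewrite mulrA ler_wpM2r ?sqr_ge0.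
Qed.

Let quad1 : quad (fun x y => overlap x y - c) <= B * W.
Proof.
rewrite (_ : (fun x y => _) =
  kernel_of (fun S => coef w S - c * (S == zerov _)%:R)).
  exact: quad_coef_le.
apply/funext => x; apply/funext => y; rewrite /overlap -kernel_block_coef /kernel_of.
under [RHS]eq_bigr do rewrite !mulrBl.
rewrite sumrB; congr (_ - _); rewrite (bigD1 (zerov _))//= eqxx !chi0 !mulr1.
by rewrite big1 ?addr0// => S /negbTE ->; rewrite mulr0 !mul0r.
Qed.

Let quad_pow m : quad (fun x y => overlap x y ^+ m.+2) <=
  B * (tau^-1 ^+ size w) ^+ m.+2 * W.
Proof.
pose t := flatten (nseq m w).
have st : size t = (size w * m)%N.
  by rewrite size_flatten /shape map_nseq sumn_nseq.
have powE x y : overlap x y ^+ m.+2 = kernel_of (coef (t ++ w ++ w)) x y.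
  rewrite kernel_block_coef !big_cat /= big_flatten /= big_nseq.
  rewrite -/(overlap x y) !exprSr -mulrA; congr (_ * _).
  by rewrite iter_mulr_1.
rewrite (_ : (fun x y => _) = kernel_of (coef (t ++ w ++ w))); last first.
  by apply/funext => x; apply/funext => y.
apply: quad_coef_le => S.
apply: (le_trans (block_coef_cat_le rd t tau0 tau1 coef2 S)).
rewrite ler_wpM2r ?exprn_ge0 ?(ltW tau0)// ler_wpM2l// st exprM.
(* Only [m] copies of the word are charged, the last two being covered by [coef2]; the base is at
   least 1, so the exponent may rise to [m.+2] to match the Taylor coefficient. *)
rewrite ler_weXn2l//; last by lia.
by rewrite exprn_ege1// invf_ge1.
Qed.

(** Taylor expansion: the constant term cancels, the linear term is controlled by [coef1], and the
    higher powers by [quad_pow], whose bounds sum to at most another exponential. *)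
Lemma exp_quadratic_le :
  \sum_(x in A) \sum_(y in A) (expR (overlap x y - c) - 1) <=
  B * (1 + expR (tau^-1 ^+ size w)) * W.
Proof.
set T := tau^-1 ^+ size w.
have T0 : 0 <= T by rewrite exprn_ge0// invr_ge0 ltW.
set C := B * (1 + expR T) * W.
have C0 : 0 <= C by rewrite !mulr_ge0// addr_ge0 ?expR_ge0.
have hexp : quad (fun x y => expR (overlap x y) - 1 - c) <= C.
  have lim : quad (fun x y => series (exp_coeff (overlap x y)) n - 1 - c)
      @[n --> \oo] --> quad (fun x y => expR (overlap x y) - 1 - c).
    apply: cvg_sumr => x; apply: cvg_sumr => y.
    apply: cvgB; last exact: cvg_cst.
    apply: cvgB; last exact: cvg_cst.
    exact: is_cvg_series_exp_coeff.
  apply: (cvgr_to_le lim); exists 2%N => // n /= n2.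
  have -> : n = (n - 2).+2 by lia.
  move: (n - 2)%N => {n n2} m.
  have e : quad (fun x y => series (exp_coeff (overlap x y)) m.+2 - 1 - c) =
      quad (fun x y => overlap x y - c) +
      \sum_(i < m) quad (fun x y => overlap x y ^+ i.+2) / (i.+2)`!%:R.
    rewrite /quad.
    under [X in _ = _ + X]eq_bigr do rewrite mulr_suml.
    rewrite [X in _ = _ + X]exchange_big -big_split/=; apply: eq_bigr => x _.
    under [X in _ = _ + X]eq_bigr do rewrite mulr_suml.
    rewrite [X in _ = _ + X]exchange_big -big_split/=; apply: eq_bigr => y _.
    rewrite /series /= big_mkord !big_ord_recl /= /exp_coeff /= !expr0 !expr1.
    rewrite /bump leq0n addn0 fact0 (_ : 1`! = 1%N)// !divr1.
    under [X in _ + (_ + X)]eq_bigr do rewrite !add1n.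
    by set s := \sum_(i < m) _; lra.
  rewrite e /C -mulrA mulrDl mulrDr mul1r lerD//.
  have step (i : 'I_m) : quad (fun x y => overlap x y ^+ i.+2) / (i.+2)`!%:R <=
     B * W * exp_coeff T i.+2.
    rewrite /exp_coeff /= mulrA ler_pM2r ?invr_gt0 ?ltr0n ?fact_gt0//.
    by rewrite mulrAC quad_pow.
  apply: (le_trans (ler_sum _ (fun i _ => step i))).
  rewrite -mulr_sumr [B * (_ * W)]mulrCA mulrC ler_wpM2r ?mulr_ge0//.
  apply: le_trans (series_exp_coeff_le m.+2 T0).
  rewrite /series /= big_mkord !big_ord_recl /= addrA lerDr.
  by rewrite addr_ge0// exp_coeff_ge0.
(* Expanding the right side reduces this to [expR (- c) * (1 + c) <= 1]. *)
have pt x y : expR (overlap x y - c) - 1 <=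
    expR (- c) * (expR (overlap x y) - 1 - c).
  have h : expR (- c) * (1 + c) <= 1.
    by rewrite -[leRHS]expR0 -(addNr c) expRD ler_pM2l ?expR_gt0// expR_ge1Dx.
  by rewrite expRD; nra.
apply: (@le_trans _ _ (expR (- c) * quad (fun x y => expR (overlap x y) - 1 - c))).
  rewrite mulr_sumr; apply: ler_sum => x _; rewrite mulr_sumr.
  by apply: ler_sum => y _; exact: pt.
apply: (le_trans (ler_wpM2l (expR_ge0 _) hexp)).
by rewrite ler_piMl// -[leRHS]expR0 ler_expR oppr_le0.
Qed.

End ExpKernel.

(** * Coefficients of the labelling word *)

Section Coefficients.
Context (R : realType) (k K d : nat) (pi : 'I_k -> 'I_K) (r : R).
Hypotheses (r0 : 0 <= r) (r1 : r <= 1) (rd : r ^+ 2 * d%:R = 1).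
Local Notation V := {ffun 'I_K * 'I_d -> bool}.
Implicit Types (S x y : V).

Definition label_word : seq 'I_K := [seq pi l | l <- enum 'I_k].
Local Notation coef := (@block_coef R K d r).

Lemma size_label_word : size label_word = k.
Proof. by rewrite size_map size_enum_ord. Qed.

Lemma count_label_word i : count_mem i label_word = #|[pred l | pi l == i]|.
Proof.
by rewrite count_map -size_filter cardE enumT; congr size; apply: eq_filter.
Qed.

(** In the support, every block whose label has odd multiplicity has odd weight, hence weight at
    least 1. *)
Lemma oddness_le_weight S : coef label_word S != 0 -> (oddness pi <= weight S)%N.
Proof.
move=> /block_coef_support[_ h]; rewrite sum_block_weight /oddness -sum1_card.
rewrite big_mkcond /=; apply: leq_sum => i _.
rewrite inE -count_label_word -h; case: (block_weight i S) => [|m] //=.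
by case: ifP.
Qed.

Lemma even_weight_ge2 S : oddness pi = 0%N -> coef label_word S != 0 ->
  S != zerov _ -> (2 <= weight S)%N.
Proof.
move=> o0 /block_coef_support[_ h] S0.
have even i : ~~ odd (block_weight i S).
  have /card0_eq/(_ i) := o0; rewrite inE h count_label_word => ->.
  by [].
rewrite ltnNge; apply: contra S0; rewrite leq_eqVlt ltnS leqn0.
have : ~~ odd (weight S).
  rewrite sum_block_weight; elim/big_ind: _ => // a b; rewrite oddD.
  by move=> /negbTE -> /negbTE ->.
by case: eqP => [->//|_ _]; rewrite /= weight0_eq.
Qed.

(** Labels of odd multiplicity lie in the image of [pi]. This keeps the exponent [k + oddness pi]
    within the allowed [k.*2]. *)
Lemma oddness_le : (oddness pi <= k)%N.
Proof.
rewrite /oddness -[X in (_ <= X)%N]card_ord.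
rewrite (leq_trans _ (leq_image_card pi predT))//.
apply: subset_leq_card; apply/fintype.subsetP => i; rewrite inE => oi.
have : (0 < #|[pred l | pi l == i]|)%N by case: (#|_|) oi.
by move=> /card_gt0P[l]; rewrite inE => /eqP <-; exact: codom_f.
Qed.

(** The factorial covers words of length up to 2k, and [tau^-1 ^+ k.*2] compensates
    [tau ^+ weight S] for weights up to 2k. *)
Definition coef_bound (tau : R) (e : nat) : R :=
  ((k.*2.+1)`!)%:R * tau^-1 ^+ k.*2 * r ^+ e.

Lemma coef_bound_ge0 tau e : 0 < tau -> 0 <= coef_bound tau e.
Proof.
by move=> t0; rewrite /coef_bound !mulr_ge0 ?exprn_ge0 ?invr_ge0 ?(ltW t0).
Qed.

Lemma coef_le_bound (tau : R) e (t : seq 'I_K) S : 0 < tau -> tau <= 1 ->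
  (size t <= k.*2)%N -> (weight S <= size t)%N -> (e <= size t + weight S)%N ->
  coef t S <= coef_bound tau e * tau ^+ weight S.
Proof.
move=> t0 t1 st wS he; apply: (le_trans (block_coef_le r0 rd t S)).
have h1 : r ^+ (size t + weight S) <= r ^+ e by rewrite ler_wiXn2l.
have h2 : ((size t).+1`!)%:R <= ((k.*2.+1)`!)%:R :> R.
  by rewrite ler_nat leq_fact.
have h3 : 1 <= tau^-1 ^+ k.*2 * tau ^+ weight S.
  rewrite exprVn ler_pdivlMl ?exprn_gt0// mulr1 ler_wiXn2l ?(ltW t0)//.
  exact: leq_trans st.
have -> : coef_bound tau e * tau ^+ weight S =
    ((k.*2.+1)`!)%:R * r ^+ e * (tau^-1 ^+ k.*2 * tau ^+ weight S).
  by rewrite /coef_bound -!mulrA; congr (_ * _); rewrite mulrCA.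
apply: le_trans (ler_peMr _ h3); last by rewrite mulr_ge0// exprn_ge0.
by rewrite ler_pM// exprn_ge0.
Qed.

Lemma coef_square_le (tau : R) e S : 0 < tau -> tau <= 1 -> (e <= k.*2)%N ->
  coef (label_word ++ label_word) S <= coef_bound tau e * tau ^+ weight S.
Proof.
move=> t0 t1 ek; have [->|n0] := eqVneq (coef (label_word ++ label_word) S) 0.
  by rewrite mulr_ge0 ?coef_bound_ge0// exprn_ge0// ltW.
have [wS _] := block_coef_support n0.
apply: coef_le_bound => //; rewrite size_cat size_label_word addnn//.
by rewrite (leq_trans ek)// leq_addr.
Qed.

(** Either the shift [c] absorbs the coefficient, or the weight of [S] supplies the factor [r ^+ e];
    the disjunction serves centred and uncentred references alike. *)
Lemma coef_shift_le (tau c : R) e S : 0 < tau -> tau <= 1 -> 0 <= c ->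
  (coef label_word S <= c * (S == zerov _)%:R \/ (e <= k + weight S)%N) ->
  coef label_word S - c * (S == zerov _)%:R <= coef_bound tau e * tau ^+ weight S.
Proof.
move=> t0 t1 c0 h.
have b0 : 0 <= coef_bound tau e * tau ^+ weight S.
  by rewrite mulr_ge0 ?coef_bound_ge0// exprn_ge0// ltW.
have [h0|n0] := lerP (coef label_word S) (c * (S == zerov _)%:R).
  by rewrite (le_trans _ b0)// subr_le0.
case: h => [|he]; first by rewrite leNgt n0.
rewrite (@le_trans _ _ (coef label_word S))//.
  by rewrite gerBl mulr_ge0.
have cn0 : coef label_word S != 0.
  by rewrite gt_eqF// (le_lt_trans _ n0)// mulr_ge0.
have [wS _] := block_coef_support cn0.
by apply: coef_le_bound => //; rewrite size_label_word// -addnn leq_addr.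
Qed.

End Coefficients.

(** * The Rademacher prior and its centring *)

Section Prior.
Context (R : realType) (k K d : nat) (pi : 'I_k -> 'I_K).
Hypothesis d0 : (0 < d)%N.
Local Notation V := {ffun 'I_K * 'I_d -> bool}.
Implicit Types (x y : V).
Local Notation r := ((Num.sqrt d%:R)^-1 : R).

Lemma scale_ge0 : 0 <= r. Proof. by rewrite invr_ge0 sqrtr_ge0. Qed.

Lemma scale_sqr : r ^+ 2 * d%:R = 1.
Proof. by rewrite exprVn sqr_sqrtr// mulVf// pnatr_eq0 -lt0n. Qed.

Lemma scale_le1 : r <= 1.
Proof.
rewrite invf_le1 ?sqrtr_gt0 ?ltr0n//.
by rewrite -[leLHS]sqrtr1 ler_sqrt// ler1n.
Qed.

Lemma powR_half_scale m : d%:R `^ (m%:R / 2) = (Num.sqrt d%:R) ^+ m :> R.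
Proof.
by rewrite mulrC powRrM powR12_sqrt// powR_mulrn// sqrtr_ge0.
Qed.

Definition rademacher x (i : 'I_K) (a : 'I_d) : R := (-1) ^+ x (i, a).

Definition rademacher_tensor x : tensor R k d := pure_tensor pi (rademacher x).

Definition rademacher_mean x (i : 'I_#|{: tindex k d}|) : R :=
  entry (rademacher_tensor x) (enum_val i) / (d%:R `^ (k%:R / 2)).

Lemma euclid_norm_rademacher x i :
  euclid_norm (rademacher x i) = Num.sqrt d%:R.
Proof.
rewrite /euclid_norm (eq_bigr (fun=> 1)) ?sumr_const ?card_ord// => a _.
by rewrite sqrr_sign.
Qed.

(** Inner products of pure tensors factor over the legs; the two normalisations by d^(k/2) give one
    [r ^+ 2] per leg. *)
Lemma dot_rademacher_mean x y :
  \sum_i rademacher_mean x i * rademacher_mean y i =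
  overlap r (label_word pi) x y.
Proof.
pose F (j : tindex k d) := \prod_l (r ^+ 2 * (rademacher x (pi l) (j l) *
  rademacher y (pi l) (j l))).
transitivity (\sum_j F j).
  rewrite [RHS](reindex _ (onW_bij _ (@enum_val_bij (tindex k d)))) /=.
  apply: eq_bigr => i _; rewrite /rademacher_mean /rademacher_tensor.
  rewrite /pure_tensor !tensor_ofE powR_half_scale mulrACA -big_split/=.
  rewrite /F [in RHS]big_split/=.
  rewrite mulrC; congr (_ * _).
  by rewrite prodr_const card_ord -[(_ ^+ k)^-1]exprVn -expr2 exprAC.
rewrite /F -(bigA_distr_bigA (fun l a => r ^+ 2 * (rademacher x (pi l) a *
  rademacher y (pi l) a))).
rewrite /overlap big_map big_enum /=; apply: eq_bigr => l _.
by rewrite /block_mean mulr_sumr.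
Qed.

Lemma overlap_self x : overlap r (label_word pi) x x = 1.
Proof.
rewrite /overlap big1// => i _; rewrite /block_mean.
under eq_bigr do rewrite -expr2 sqrr_sign.
by rewrite sumr_const card_ord scale_sqr.
Qed.

Let N : R := #|{: V}|%:R.
Let N0 : N != 0.
Proof. by rewrite pnatr_eq0 -lt0n; apply/card_gt0P; exists (zerov _). Qed.

Definition mean_overlap : R := @block_coef R K d r (label_word pi) (zerov _).

Lemma mean_overlap_ge0 : 0 <= mean_overlap.
Proof. exact: block_coef_ge0. Qed.

Lemma sum_overlap x :
  \sum_y overlap r (label_word pi) x y = N * mean_overlap.
Proof.
by rewrite /overlap; under eq_bigr do rewrite -kernel_block_coef; exact: sum_kernel.
Qed.

Definition prior_mean (i : 'I_#|{: tindex k d}|) : R :=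
  N^-1 * \sum_x rademacher_mean x i.

(** Every [x] has the same inner product with the prior mean, by [sum_overlap], so centring
    subtracts one constant from all overlaps. *)
Lemma dot_centered x y :
  \sum_i (rademacher_mean x i - prior_mean i) * (rademacher_mean y i - prior_mean i) =
  overlap r (label_word pi) x y - mean_overlap.
Proof.
have cross z : \sum_i rademacher_mean z i * prior_mean i = mean_overlap.
  rewrite /prior_mean; under eq_bigr do rewrite mulrCA mulr_sumr.
  rewrite -mulr_sumr exchange_big/=.
  under eq_bigr do rewrite dot_rademacher_mean.
  by rewrite sum_overlap mulrA mulVf// mul1r.
have self : \sum_i prior_mean i * prior_mean i = mean_overlap.
  rewrite {1}/prior_mean; under eq_bigr do rewrite -mulrA mulr_suml.
  rewrite -mulr_sumr exchange_big/=.
  under eq_bigr do rewrite cross.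
  by rewrite sumr_const -mulr_natl mulrA mulVf// mul1r.
transitivity (\sum_i (rademacher_mean x i * rademacher_mean y i -
    rademacher_mean x i * prior_mean i - rademacher_mean y i * prior_mean i +
    prior_mean i * prior_mean i)).
  by apply: eq_bigr => i _; ring.
by rewrite big_split/= !sumrB !cross self dot_rademacher_mean subrK.
Qed.

End Prior.

(** * Inadmissible answers and runs of an algorithm *)

(** The tolerance involves the true mean [p], while Cauchy-Schwarz sees the variance at the
    reference mean [p0]. A violation exceeds 1/n, so the gap is at most n times its square, and
    passing from [p] to [p0] costs only the factor 2. *)
Lemma vstat_violation (R : realType) (p p0 : R) n : (0 < n)%N ->
  0 <= p <= 1 -> 0 <= p0 <= 1 ->
  Num.max (n%:R^-1) (Num.sqrt (p * (1 - p) / n%:R)) < `|p0 - p| ->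
  p0 * (1 - p0) < 2 * n%:R * (p0 - p) ^+ 2.
Proof.
move=> n0 /andP[p0' p1'] /andP[q0 q1]; rewrite gt_max => /andP[h1 h2].
have nr : 0 < n%:R :> R by rewrite ltr0n.
set D := `|p0 - p| in h1 h2.
have D0 : 0 <= D by rewrite normr_ge0.
have -> : (p0 - p) ^+ 2 = D ^+ 2 by rewrite /D real_normK// num_real.
have hn : 1 < n%:R * D by rewrite -ltr_pdivrMl// mulr1.
have hs : p * (1 - p) < n%:R * D ^+ 2.
  rewrite [ltRHS]mulrC -ltr_pdivrMr//.
  have := h2; rewrite -(ltr_pXn2r (n := 2))// ?nnegrE ?sqrtr_ge0//.
  rewrite sqr_sqrtr; first by [].
  by rewrite divr_ge0 ?(ltW nr)// mulr_ge0// subr_ge0.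
(* The function t (1 - t) is 1-Lipschitz on [0, 1]. *)
have hd : p0 * (1 - p0) <= p * (1 - p) + D.
  have /ler_normlP[u1 u2] : `|p0 - p| <= D by [].
  have [c|c] := lerP p p0; nra.
have : D <= n%:R * D ^+ 2.
  by rewrite expr2 mulrA ler_peMl// ltW.
by nra.
Qed.

Lemma query_mean01 (R : realType) k d (D : probability (tensor R k d) R)
    (q : query R k d) :
  0 <= query_mean D q <= 1.
Proof.
have q0 T : 0 <= q T by have /andP[] := query_bounded q T.
have e0 : (0 <= 'E_D[q])%E by exact: expectation_ge0.
have e1 : ('E_D[q] <= 1)%E.
  rewrite -[leRHS](@expectation_cst _ _ _ D 1); apply: expectation_le => //.
  - exact: measurable_query.
  - by apply/aeW => T; have /andP[] := query_bounded q T.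
rewrite /query_mean; case: ('E_D[q])%E e0 e1 => //= r; rewrite !lee_fin => -> //.
Qed.

Definition spread_const (R : realType) k (rho : R) : R :=
  ((k.*2.+1)`!)%:R * (rho ^+ 2)^-1 ^+ k.*2 * (1 + expR ((rho ^+ 2)^-1 ^+ k)).

Lemma spread_const_ge0 (R : realType) k (rho : R) : 0 <= spread_const k rho.
Proof.
apply: mulr_ge0; last by rewrite addr_ge0 ?expR_ge0.
by apply: mulr_ge0 => //; apply: exprn_ge0; rewrite invr_ge0 sqr_ge0.
Qed.

Section BadQueries.
Context (R : realType) (k K d : nat) (pi : 'I_k -> 'I_K) (p n e : nat) (c rho : R)
  (b : 'I_#|{: tindex k d}| -> R).
Local Notation V := {ffun 'I_K * 'I_d -> bool}.
Local Notation r := ((Num.sqrt d%:R)^-1 : R).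
Local Notation tau := (rho ^+ 2).
Hypotheses (d0 : (0 < d)%N) (n0 : (0 < n)%N) (p0 : (0 < p)%N) (ek : (e <= k.*2)%N).
Hypotheses (c0 : 0 <= c) (tau0 : 0 < tau) (tau1 : tau * (p.*2.-1)%:R <= 1).
Hypothesis dotE : forall x y : V,
  \sum_i (rademacher_mean R pi x i - b i) * (rademacher_mean R pi y i - b i) =
  overlap r (label_word pi) x y - c.
Hypothesis coefE : forall S : V,
  block_coef r (label_word pi) S <= c * (S == zerov _)%:R \/ (e <= k + weight S)%N.

Let tau_le1 : tau <= 1.
Proof.
apply: le_trans tau1; rewrite ler_peMr ?(ltW tau0)// ler1n.
by lia.
Qed.

Let spread_ge0 : 0 <= spread_const k rho * r ^+ e.
Proof.
by apply: mulr_ge0 (spread_const_ge0 _ _) (exprn_ge0 e (scale_ge0 R d)).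
Qed.

(** The exponential bound followed by the level inequality. Taking [p]-th powers needs a nonnegative
    sum; the negative case is excluded later by Cauchy-Schwarz. *)
Lemma shift_energy_le (A : {pred V}) :
  (\sum_(x in A) \sum_(y in A) (expR (overlap r (label_word pi) x y - c) - 1)) ^+ p <=
  (spread_const k rho * r ^+ e) ^+ p * (#|{: V}|%:R * #|A|%:R ^+ p.*2.-1) \/
  \sum_(x in A) \sum_(y in A) (expR (overlap r (label_word pi) x y - c) - 1) < 0.
Proof.
set Q := \sum_(x in A) _.
have [Q0|] := lerP 0 Q; [left|by right].
have := exp_quadratic_le (scale_sqr R d0) A tau0 tau_le1 c0
  (coef_bound_ge0 k (scale_ge0 R d) e tau0)
  (fun S => coef_shift_le (scale_ge0 R d) (scale_le1 R d0) (scale_sqr R d0)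
     tau0 tau_le1 c0 (coefE S))
  (fun S => coef_square_le pi (scale_ge0 R d) (scale_le1 R d0) (scale_sqr R d0) S
     tau0 tau_le1 ek).
rewrite size_label_word -/Q => hQ.
have C0 := spread_ge0.
apply: le_trans (ler_wpM2l (exprn_ge0 p C0) (level_inequality A p0 tau1)).
rewrite -exprMn lerXn2r ?nnegrE//.
  apply: mulr_ge0 => //; apply: sumr_ge0 => S _; rewrite mulr_ge0 ?sqr_ge0//.
  by rewrite exprn_ge0// ltW.
rewrite (le_trans hQ)// le_eqVlt; apply/orP; left; apply/eqP.
by rewrite /coef_bound /spread_const; congr (_ * _); rewrite mulrAC.
Qed.

Let P0 : probability (tensor R k d) R := normal_tuple_law b.
Let mean (x : V) (q : query R k d) :=
  query_mean (signal_law (rademacher_tensor R pi x)) q.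

Definition bad_set (q : query R k d) : {set V} :=
  [set x | ~~ (`|query_mean P0 q - mean x q| <= Num.max (n%:R^-1)
      (Num.sqrt (mean x q * (1 - mean x q) / n%:R)))].

(** Deviations of one sign add without cancellation, so Cauchy-Schwarz gives |A|^2 <= 2 n Q. The
    energy bound on Q^p carries |A|^(2p-1), and one power of |A| survives. *)
Lemma signed_bad_set_le (s : bool) (q : query R k d) (A : {pred V}) :
  (forall x, x \in A -> x \in bad_set q /\
     0 <= (-1) ^+ s * (mean x q - query_mean P0 q)) ->
  #|A|%:R <= (2 * n%:R * (spread_const k rho * r ^+ e)) ^+ p * #|{: V}|%:R.
Proof.
move=> hA; set v := query_mean P0 q * (1 - query_mean P0 q).
have v0 : 0 <= v.
  by have /andP[? ?] := query_mean01 P0 q; rewrite mulr_ge0// subr_ge0.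
set Q := \sum_(x in A) \sum_(y in A) (expR (overlap r (label_word pi) x y - c) - 1).
have nr : 0 < n%:R :> R by rewrite ltr0n.
have C0 := spread_ge0.
have [A0|An0] := eqVneq #|A| 0%N.
  by rewrite A0 mulr_ge0// exprn_ge0// mulr_ge0// mulr_ge0.
have Ar : 0 < #|A|%:R :> R by rewrite ltr0n lt0n.
have main : \sum_(x in A) (-1) ^+ s * (mean x q - query_mean P0 q) <=
    Num.sqrt v * Num.sqrt Q.
  pose a x : R := if x \in A then (-1) ^+ s else 0.
  have := sum_mean_shift_le b (@rademacher_mean R k K d pi) a
    (measurable_query q) (query_bounded q).
  have -> : \sum_x \sum_y a x * a y * (expR (\sum_i (rademacher_mean R pi x i - b i) *
      (rademacher_mean R pi y i - b i)) - 1) = Q.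
    rewrite /Q [RHS]big_mkcond; apply: eq_bigr => x _; rewrite /a.
    case: ifP => _; last by rewrite big1// => y _; rewrite !mul0r.
    rewrite [RHS]big_mkcond; apply: eq_bigr => y _.
    case: ifP => _; last by rewrite mulr0 mul0r.
    by rewrite -expr2 sqrr_sign mul1r dotE.
  rewrite [X in X <= _ -> _](_ : _ =
    \sum_(x in A) (-1) ^+ s * (mean x q - query_mean P0 q))//.
  rewrite [RHS]big_mkcond; apply: eq_bigr => x _; rewrite /a.
  by case: ifP => _; rewrite ?mul0r.
have dev x : x \in A -> Num.sqrt (v / (2 * n%:R)) <
    (-1) ^+ s * (mean x q - query_mean P0 q).
  move=> xA; have [+ sg] := hA x xA; rewrite inE -ltNge => /vstat_violation h.
  have {}h := h n0 (query_mean01 _ _) (query_mean01 _ _).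
  rewrite -(ltr_pXn2r (n := 2)) ?nnegrE ?sqrtr_ge0// sqr_sqrtr; last first.
    by rewrite divr_ge0// mulr_ge0.
  rewrite ltr_pdivrMr ?mulr_gt0// mulrC exprMn sqrr_sign mul1r.
  by rewrite -[X in _ * X]sqrrN opprB.
have sumdev : #|A|%:R * Num.sqrt (v / (2 * n%:R)) < Num.sqrt v * Num.sqrt Q.
  apply: lt_le_trans main; rewrite mulr_natl -sumr_const.
  have /card_gt0P[x0 x0A] : (0 < #|A|)%N by rewrite lt0n.
  rewrite (bigD1 x0)//= [ltRHS](bigD1 x0)//= ltr_leD ?dev//.
  by apply: ler_sum => x /andP[xA _]; rewrite ltW ?dev.
(* Strictness in [sumdev] excludes a degenerate query, so the square root of [v] can be
   cancelled. *)
have vpos : 0 < v.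
  rewrite lt_neqAle v0 andbT; apply: contraTneq sumdev => <-.
  by rewrite mul0r sqrtr0 mulr0 mul0r ltxx.
have Qpos : 0 < Q.
  rewrite ltNge; apply: contraTN sumdev => Q0.
  by rewrite (ler0_sqrtr Q0) mulr0 -leNgt mulr_ge0// sqrtr_ge0.
have AQ : #|A|%:R ^+ 2 <= 2 * n%:R * Q.
  have h := ltW sumdev; rewrite sqrtrM// mulrCA ler_pM2l ?sqrtr_gt0// in h.
  have n2 : 0 <= 2 * n%:R :> R by rewrite mulr_ge0.
  rewrite sqrtrV// ler_pdivrMr ?sqrtr_gt0 ?mulr_gt0// in h.
  rewrite -(sqr_sqrtr n2) -(sqr_sqrtr (ltW Qpos)) -exprMn mulrC.
  by rewrite lerXn2r// nnegrE ?mulr_ge0 ?sqrtr_ge0// ltW.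
case: (shift_energy_le A) => [|]; last by rewrite -/Q ltNge ltW.
rewrite -/Q => hQ.
have h1 : (#|A|%:R ^+ 2) ^+ p <= (2 * n%:R * Q) ^+ p :> R.
  by rewrite lerXn2r// nnegrE ?sqr_ge0// !mulr_ge0// ltW.
rewrite [leRHS]exprMn in h1.
have h2 := le_trans h1 (ler_wpM2l (exprn_ge0 p (mulr_ge0 (ler0n R 2) (ltW nr))) hQ).
rewrite [leRHS]mulrA -[X in _ <= X * _]exprMn in h2.
move: h2; rewrite -exprM mul2n.
have ep : p.*2 = (p.*2.-1).+1 by rewrite prednK// double_gt0.
by rewrite {1}ep exprS [X in _ <= X -> _]mulrA ler_pM2r// exprn_gt0.
Qed.

Lemma bad_set_le (q : query R k d) :
  #|bad_set q|%:R <= 2 * (2 * n%:R * (spread_const k rho * r ^+ e)) ^+ p * #|{: V}|%:R.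
Proof.
pose A (s : bool) : {pred V} := [pred x | (x \in bad_set q) &&
  (0 <= (-1) ^+ s * (mean x q - query_mean P0 q))].
have hA s : #|A s|%:R <= (2 * n%:R * (spread_const k rho * r ^+ e)) ^+ p * #|{: V}|%:R.
  by apply: (@signed_bad_set_le s q (A s)) => x; rewrite inE => /andP[].
have : (#|bad_set q| <= #|A false| + #|A true|)%N.
  rewrite -cardUI (leq_trans _ (leq_addr _ _))//; apply: subset_leq_card.
  apply/fintype.subsetP => x xb; apply/orP.
  have [pos|neg] := lerP 0 (mean x q - query_mean P0 q); [left|right]; apply/andP.
    by split; rewrite // mul1r.
  by split; rewrite // mulN1r oppr_ge0 ltW.
rewrite -(ler_nat R) natrD => /le_trans; apply.
by rewrite -mulrA mulr_natl mulr2n lerD// hA.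
Qed.

End BadQueries.

(** * Runs against a fixed response function *)

Section Run.
Context (R : realType) (k d : nat) (Out : Type) (T : finType) (M : R)
  (bad : query R k d -> {set T}).
Hypothesis M0 : 0 <= M.
Hypothesis badM : forall q, #|bad q|%:R <= M.

(** The run against [O0] asks at most [B] queries, whatever [x] is, and [Bad] is the union of their
    bad sets. Outside it all answers coincide, hence also all adaptive choices. *)
Lemma sq_run_agree (A : sq_algorithm R k d Out) (O0 : query R k d -> R) B h :
  exists2 Bad : {set T}, #|Bad|%:R <= B%:R * M &
  forall x, x \notin Bad -> forall O : query R k d -> R,
    (forall q, x \notin bad q -> O q = O0 q) -> sq_run A O B h = sq_run A O0 B h.
Proof.
elim: B h => [|B IH] h.
  by exists finset.set0; [rewrite finset.cards0 mul0r|].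
case Ah : (A h) => [q|out]; last first.
  exists finset.set0.
    by rewrite finset.cards0 mulr_ge0.
  by move=> x _ O _ /=; rewrite Ah.
have [Bad BadM hBad] := IH (rcons h (O0 q)).
exists (Bad :|: bad q).
  rewrite -natr1 mulrDl mul1r; apply: le_trans (lerD BadM (badM q)).
  by rewrite -natrD ler_nat; exact: leq_card_setU.
move=> x; rewrite inE negb_or => /andP[xBad xq] O hO /=.
by rewrite Ah (hO q xq) (hBad x xBad O hO).
Qed.

End Run.

Lemma entry_mean_normal (R : realType) k d (m : 'I_#|{: tindex k d}| -> R) j :
  entry (mean_tensor (normal_tuple_law m : probability (tensor R k d) R)) j =
  normal_mean R + m (enum_rank j).
Proof.
rewrite /mean_tensor tensor_ofE unlock.
by rewrite (integral_tnth m (enum_rank j)).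
Qed.

(** The means differ at an index where every factor is nonzero; [normal_mean] cancels. *)
Lemma signal_neq_null (R : realType) k K d (pi : 'I_k -> 'I_K) (v : 'I_K -> 'I_d -> R) :
  (0 < d)%N -> (forall i, euclid_norm (v i) = Num.sqrt d%:R) ->
  signal_law (pure_tensor pi v) <> null_law R k d.
Proof.
move=> d0 hv.
have [j hj] : exists j : tindex k d, forall l, v (pi l) (j l) != 0.
  have ex i : exists a, v i a != 0.
    apply/existsP; apply: contraPT (hv i) => /existsPn v0.
    rewrite /euclid_norm big1 => [|a _]; last first.
      by have := v0 a; rewrite negbK => /eqP ->; rewrite expr0n.
    by apply/eqP; rewrite sqrtr0 eq_sym gt_eqF// sqrtr_gt0 ltr0n.
  exists [ffun l => xchoose (ex (pi l))] => l; rewrite ffunE.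
  exact: (xchooseP (ex (pi l))).
move=> /(congr1 (fun D => entry (mean_tensor D) j)).
rewrite [LHS]entry_mean_normal [RHS]entry_mean_normal => /addrI/eqP.
have dn : d%:R `^ (k%:R / 2) != 0 :> R by rewrite gt_eqF// powR_gt0// ltr0n.
rewrite enum_rankK tensor_ofE mulf_eq0 invr_eq0 (negbTE dn) orbF.
by rewrite prodf_seq_eq0 => /hasP[l _]; rewrite (negbTE (hj l)).
Qed.

(** * Testing and estimation against reference answers *)

Section Assembly.
Context (R : realType) (k K d : nat) (pi : 'I_k -> 'I_K) (p n e : nat) (c rho : R)
  (b : 'I_#|{: tindex k d}| -> R).
Local Notation V := {ffun 'I_K * 'I_d -> bool}.
Local Notation r := ((Num.sqrt d%:R)^-1 : R).
Local Notation tau := (rho ^+ 2).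
Hypotheses (d0 : (0 < d)%N) (n0 : (0 < n)%N) (p0 : (0 < p)%N) (ek : (e <= k.*2)%N).
Hypotheses (c0 : 0 <= c) (tau0 : 0 < tau) (tau1 : tau * (p.*2.-1)%:R <= 1).
Hypothesis dotE : forall x y : V,
  \sum_i (rademacher_mean R pi x i - b i) * (rademacher_mean R pi y i - b i) =
  overlap r (label_word pi) x y - c.
Hypothesis coefE : forall S : V,
  block_coef r (label_word pi) S <= c * (S == zerov _)%:R \/ (e <= k + weight S)%N.

Let P0 : probability (tensor R k d) R := normal_tuple_law b.
Let D (x : V) := signal_law (rademacher_tensor R pi x).
Definition bad_density : R := 2 * (2 * n%:R * (spread_const k rho * r ^+ e)) ^+ p.

Lemma indistinguishable Out (A : sq_algorithm R k d Out) B :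
  exists2 Bad : {set V}, #|Bad|%:R <= B%:R * (bad_density * #|{: V}|%:R) &
  forall x, x \notin Bad -> exists2 O, is_vstat (D x) n O &
    sq_run A O B [::] = sq_run A (query_mean P0) B [::].
Proof.
have badM := bad_set_le d0 n0 p0 ek c0 tau0 tau1 dotE coefE.
(* Nonnegativity is read off the bad set of a constant query. *)
have M0 : 0 <= bad_density * #|{: V}|%:R.
  have h01 (T : tensor R k d) : 0 <= cst (0 : R) T <= 1 by rewrite lexx ler01.
  exact: le_trans (ler0n R _) (badM (Query (@measurable_cst _ _ _ _ _ _) h01)).
have [Bad cBad hBad] := sq_run_agree M0 badM A (query_mean P0) B [::].
exists Bad => // x xBad.
(* The reference answer when admissible, the true mean otherwise: a valid oracle for every [x]. *)
exists (fun q =>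
  if x \in bad_set pi n b q then query_mean (D x) q else query_mean P0 q).
  move=> q; case: ifPn => [_|].
    by rewrite subrr normr0 le_max invr_ge0 ler0n.
  by rewrite inE negbK.
by apply: (hBad x xBad) => q /negbTE ->.
Qed.

Let entry_mean (x : V) j : entry (mean_tensor (D x)) j =
  normal_mean R + rademacher_mean R pi x (enum_rank j).
Proof. exact: entry_mean_normal. Qed.

Let sum_sqr_rademacher (s : bool) (x y : V) :
  \sum_i (rademacher_mean R pi x i + (-1) ^+ s * rademacher_mean R pi y i) ^+ 2 =
  2 + (-1) ^+ s * (2 * overlap r (label_word pi) x y).
Proof.
transitivity (\sum_i (rademacher_mean R pi x i * rademacher_mean R pi x i +
    rademacher_mean R pi y i * rademacher_mean R pi y i +
    (-1) ^+ s * (2 * (rademacher_mean R pi x i * rademacher_mean R pi y i)))).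
  by apply: eq_bigr => i _; case: s; rewrite ?expr0 ?expr1; ring.
rewrite !big_split/= -!mulr_sumr !dot_rademacher_mean !overlap_self//.
Qed.

(** If fewer than a quarter of the points were bad, the others would share one estimate, hence have
    overlap at least 7/8 with [x0]. As overlaps are never below -1, their average would exceed
    1/4. *)
Lemma estimation_bound (A : sq_algorithm R k d (tensor R k d)) B :
  solves_estimation pi n B A -> mean_overlap R d pi <= 1 / 4 ->
  #|{: V}|%:R <= 4 * (B%:R * (bad_density * #|{: V}|%:R)).
Proof.
move=> solves small; have [Bad cBad hBad] := indistinguishable A B.
apply: (@le_trans _ _ (4 * #|Bad|%:R)); last by rewrite ler_pM2l.
rewrite leNgt; apply/negP => few.
have cC : #|Bad|%:R + #|~: Bad|%:R = #|{: V}|%:R :> R by rewrite -natrD finset.cardsC.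
have N0 : 0 < #|{: V}|%:R :> R.
  by rewrite ltr0n; apply/card_gt0P; exists (zerov _).
have [x0 x0G] : exists x, x \in ~: Bad.
  apply/card_gt0P; rewrite lt0n; apply/eqP => G0.
  by move: cC few; rewrite G0 addr0 => ->; rewrite ltNge ler_peMl// ler1n.
have close (x : V) : x \in ~: Bad -> 7 / 8 <= overlap r (label_word pi) x0 x.
  rewrite inE => xG; move: x0G; rewrite inE => x0G.
  have [oc voc roc] := hBad x xG; have [oc0 voc0 roc0] := hBad x0 x0G.
  have law (y : V) : signal_laws pi (D y).
    by exists (rademacher R y); split=> // i; exact: euclid_norm_rademacher.
  have [V1 r1 e1] := solves (D x) (law x) oc voc.
  have [V0 r0' e0] := solves (D x0) (law x0) oc0 voc0.
  have eV : V1 = V0 by move: r0' r1; rewrite roc roc0 => -> [].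
  rewrite eV in e1.
  have sqn (f : tindex k d -> R) : euclid_norm f <= 1 / 4 -> \sum_j f j ^+ 2 <= 1 / 16.
    move=> hf; have s0 : 0 <= \sum_j f j ^+ 2 by apply: sumr_ge0 => j _; exact: sqr_ge0.
    rewrite -(sqr_sqrtr s0) (_ : 1 / 16 = (1 / 4) ^+ 2 :> R); last by field.
    by rewrite lerXn2r// nnegrE ?sqrtr_ge0//; lra.
  have {}e1 := sqn _ e1; have {}e0 := sqn _ e0.
  (* Both means lie within 1/4 of the same estimate, so their squared distance [2 - 2 * overlap] is
     at most 1/4; hence 7/8. *)
  have par : \sum_j (rademacher_mean R pi x0 (enum_rank j) -
      rademacher_mean R pi x (enum_rank j)) ^+ 2 <= 1 / 4.
    apply: (@le_trans _ _ (2 * (1 / 16) + 2 * (1 / 16))); last by lra.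
    apply: le_trans (lerD (ler_wpM2l _ e0) (ler_wpM2l _ e1)) => //.
    rewrite !mulr_sumr -big_split/=; apply: ler_sum => j _.
    rewrite !entry_mean; set u := rademacher_mean _ _ x0 _.
    set v := rademacher_mean _ _ x _; set t := entry V0 j.
    (* The term discarded from the parallelogram identity. *)
    have := sqr_ge0 (2 * t - 2 * normal_mean R - u - v); nra.
  have := sum_sqr_rademacher true x0 x.
  rewrite (reindex _ (onW_bij _ (@enum_rank_bij (tindex k d)))) /= expr1 => eq_.
  have : 2 + -1 * (2 * overlap r (label_word pi) x0 x) <= 1 / 4 :> R.
    by rewrite -eq_ (le_trans _ par)//; apply: ler_sum => j _; rewrite mulN1r.
  by lra.
have lower (x : V) : - 1 <= overlap r (label_word pi) x0 x.
  have : 0 <= 2 + (-1) ^+ false * (2 * overlap r (label_word pi) x0 x) :> R.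
    by rewrite -sum_sqr_rademacher; apply: sumr_ge0 => i _; exact: sqr_ge0.
  by rewrite expr0; lra.
have total := sum_overlap R pi x0.
have : #|~: Bad|%:R * (7 / 8) - #|Bad|%:R <= \sum_x overlap r (label_word pi) x0 x.
  rewrite [leRHS](bigID (mem (~: Bad)))/= lerD//.
    by rewrite mulr_natl -sumr_const; apply: ler_sum => x; exact: close.
  rewrite -mulN1r mulrC mulr_natl -sumr_const.
  rewrite [leLHS](eq_bigl (fun x => x \notin ~: Bad)).
    by apply: ler_sum => x _; exact: lower.
  by move=> x; rewrite inE negbK.
rewrite total => h.
have hN : #|{: V}|%:R * mean_overlap R d pi <= #|{: V}|%:R * (1 / 4).
  by rewrite ler_pM2l.
by lra.
Qed.

(** A single point outside [Bad] suffices: its verdict equals the one on the null law, and either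
    verdict would identify a signal law with the null law. *)
Lemma testing_bound (A : sq_algorithm R k d verdict) B :
  b = (fun=> 0) -> solves_testing pi n B A ->
  #|{: V}|%:R <= 4 * (B%:R * (bad_density * #|{: V}|%:R)).
Proof.
move=> b0 solves; have [Bad cBad hBad] := indistinguishable A B.
apply: (@le_trans _ _ (4 * #|Bad|%:R)); last by rewrite ler_pM2l.
rewrite leNgt; apply/negP => few.
have [x xG] : exists x, x \notin Bad.
  apply/existsP; apply: contraTT few => /existsPn full.
  have -> : #|{: V}| = #|Bad|.
    by apply: eq_card => x; rewrite !inE -[RHS]negbK full.
  by rewrite -leNgt ler_peMl// ler1n.
have [oc voc roc] := hBad x xG.
have law : signal_laws pi (D x).
  by exists (rademacher R x); split=> // i; exact: euclid_norm_rademacher.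
have null : P0 = null_law R k d by rewrite /P0 b0.
have vnull : is_vstat (null_law R k d) n (query_mean P0).
  by move=> q; rewrite null subrr normr0 le_max invr_ge0 ler0n.
have [v1 r1 h1] := solves (D x) (or_intror law) oc voc.
have [v0 r0' h0] := solves (null_law R k d) (or_introl erefl) _ vnull.
have ev : v1 = v0 by move: r0' r1; rewrite roc => -> [].
rewrite ev in h1; case: v0 {r0' ev} h0 h1 => [_ Dx|[v [nv e0]] _].
  by case: law => v [nv Dv]; exact: (signal_neq_null d0 nv (etrans (esym Dv) Dx)).
exact: (signal_neq_null d0 nv (esym e0)).
Qed.

End Assembly.

(** Cancelling [N] leaves 1 <= 8 B (2 n S r^e)^p. The sample bound gives n r^e <= C0 d^(-eps), and
    eps p >= L turns the [p]-th power into d^(-L). The [+ 1] keeps the denominator positive even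
    when [C0 = 0]. *)
Lemma queries_ge (R : realType) (d L p B n e k : nat) (eps rho C0 N : R) :
  (0 < d)%N -> 0 < rho ^+ 2 -> 0 <= C0 -> L%:R <= eps * p%:R -> 0 < N ->
  n%:R <= C0 * d%:R `^ (e%:R / 2 - eps) ->
  N <= 4 * (B%:R * (bad_density k d p n e rho * N)) ->
  (8 * (2 * spread_const k rho * C0) ^+ p + 1)^-1 * d%:R ^+ L <= B%:R.
Proof.
move=> d0 tau0 C00 hp N0 hn.
have d1 : 1 <= d%:R :> R by rewrite ler1n.
have dp : 0 < d%:R :> R by rewrite ltr0n.
have S0 := spread_const_ge0 k rho.
set S := spread_const k rho in S0 *.
set r : R := (Num.sqrt d%:R)^-1.
have r0 : 0 <= r by exact: scale_ge0.
have nr : n%:R * r ^+ e <= C0 * d%:R `^ (- eps).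
  apply: le_trans (ler_wpM2r (exprn_ge0 e r0) hn) _.
  rewrite powRD; last by apply/implyP => _; rewrite gt_eqF.
  rewrite powR_half_scale /r exprVn [X in C0 * X]mulrC mulrA mulfK//.
  by rewrite expf_neq0// gt_eqF// sqrtr_gt0.
have base : 2 * n%:R * (S * r ^+ e) <= 2 * S * C0 * d%:R `^ (- eps).
  have -> : 2 * n%:R * (S * r ^+ e) = 2 * S * (n%:R * r ^+ e) by ring.
  by rewrite -[leRHS]mulrA ler_wpM2l// mulr_ge0.
have pow : (2 * n%:R * (S * r ^+ e)) ^+ p <= (2 * S * C0) ^+ p / d%:R ^+ L.
  have b0 : 0 <= 2 * n%:R * (S * r ^+ e).
    by apply: mulr_ge0; [exact: mulr_ge0|apply: mulr_ge0 => //; exact: exprn_ge0].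
  apply: (@le_trans _ _ ((2 * S * C0 * d%:R `^ (- eps)) ^+ p)).
    by rewrite lerXn2r// nnegrE// (le_trans b0).
  rewrite exprMn; apply: ler_wpM2l.
    by apply: exprn_ge0; apply: mulr_ge0 => //; exact: mulr_ge0.
  have -> : (d%:R `^ (- eps)) ^+ p = d%:R `^ (- eps * p%:R) :> R.
    by rewrite powRrM powR_mulrn ?powR_ge0.
  have -> : (d%:R ^+ L)^-1 = d%:R `^ (- L%:R) :> R.
    by rewrite powRN powR_mulrn// ltW.
  by rewrite ler_powR// mulNr lerN2.
set M := (2 * S * C0) ^+ p in pow *.
have M0 : 0 <= M by rewrite exprn_ge0// mulr_ge0// mulr_ge0.
rewrite /bad_density -/S -/r => hB.
have {hB} one : 1 <= 8 * B%:R * (2 * n%:R * (S * r ^+ e)) ^+ p.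
  rewrite -(ler_pM2r N0) mul1r (le_trans hB)//.
  by rewrite le_eqVlt; apply/orP; left; apply/eqP; ring.
have dL : 0 < d%:R ^+ L :> R by rewrite exprn_gt0.
have : d%:R ^+ L <= 8 * B%:R * M.
  rewrite -[leLHS]mul1r -ler_pdivlMr//; apply: (le_trans one).
  by rewrite -[leRHS]mulrA ler_wpM2l// mulr_ge0.
have M1 : 0 < 8 * M + 1 by rewrite ltr_wpDl// mulr_ge0.
move=> h; rewrite ler_pdivrMl//; apply: (le_trans h).
by rewrite [leRHS]mulrDl mul1r [leLHS]mulrAC lerDl.
Qed.

Theorem theorem1 (R : realType) (k L : nat) (eps : R)
    (hk : (2 <= k)%N) (heps : 0 < eps < 1) :
  exists C1 : R, forall C0 : R, 0 <= C0 ->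
  exists2 c1 : R, 0 < c1 &
  forall (K : nat) (pi : 'I_k -> 'I_K), (K <= k)%N ->
  forall d n B : nat, C1 <= d%:R -> (0 < n)%N ->
  [\/ [/\ oddness pi = 0%N,
          n%:R <= C0 * d%:R `^ (k%:R / 2 - eps) &
          exists A : sq_algorithm R k d verdict, solves_testing pi n B A],
      [/\ oddness pi = 0%N,
          n%:R <= C0 * d%:R `^ ((k%:R + 2) / 2 - eps) &
          exists A : sq_algorithm R k d (tensor R k d),
            solves_estimation pi n B A] |
      [/\ (1 <= oddness pi)%N,
          n%:R <= C0 * d%:R `^ ((k%:R + (oddness pi)%:R) / 2 - eps) &
          (exists A : sq_algorithm R k d verdict, solves_testing pi n B A) \/
          (exists A : sq_algorithm R k d (tensor R k d),
             solves_estimation pi n B A)]] ->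
  c1 * d%:R ^+ L <= B%:R.
Proof.
have /andP[e0 _] := heps.
pose p := (Num.bound (L%:R / eps)).+1.
have hp : L%:R <= eps * p%:R.
  rewrite -ler_pdivrMl// mulrC ltW// (lt_le_trans (archi_boundP _))//.
    by rewrite divr_ge0// ltW.
  by rewrite ler_nat.
(* The largest noise parameter that hypercontractivity from L2 to L2p allows here. *)
pose rho : R := (Num.sqrt (p.*2.-1)%:R)^-1.
have q0 : 0 < (p.*2.-1)%:R :> R by rewrite ltr0n.
have rhoE : rho ^+ 2 = (p.*2.-1)%:R^-1.
  by rewrite exprVn sqr_sqrtr// ltW.
have tau0 : 0 < rho ^+ 2 by rewrite rhoE invr_gt0.
have tau1 : rho ^+ 2 * (p.*2.-1)%:R <= 1 by rewrite rhoE mulVf// gt_eqF.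
(* Chosen so that [mean_overlap] is at most 1/4: it is at most (k+1)! r^k, and r^k <= 1/d because k
   >= 2. *)
exists (4 * ((k.+1)`!)%:R) => C0 C00.
have S0 := spread_const_ge0 k rho.
exists (8 * (2 * spread_const k rho * C0) ^+ p + 1)^-1.
  by rewrite invr_gt0 ltr_wpDl// mulr_ge0// exprn_ge0// mulr_ge0// mulr_ge0.
move=> K pi _ d n B hd n0.
have d1 : (0 < d)%N.
  rewrite -(ltr_nat R) (lt_le_trans _ hd)// mulr_gt0// ltr0n fact_gt0//.
pose r : R := (Num.sqrt d%:R)^-1.
have N0 : 0 < #|{: {ffun 'I_K * 'I_d -> bool}}|%:R :> R.
  by rewrite ltr0n; apply/card_gt0P; exists (zerov _).
have small : mean_overlap R d pi <= 1 / 4.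
  have w0 : weight (zerov ('I_K * 'I_d)%type) = 0%N by apply/eqP; rewrite weight0_eq.
  have := block_coef_le (scale_ge0 R d) (scale_sqr R d1) (label_word pi) (zerov _).
  rewrite size_label_word w0 addn0 => /le_trans; apply.
  have : r ^+ k <= r ^+ 2.
    by rewrite ler_wiXn2l// ?scale_ge0// scale_le1.
  have -> : r ^+ 2 = d%:R^-1 by rewrite exprVn sqr_sqrtr.
  move=> hr; apply: le_trans (ler_wpM2l _ hr) _ => //.
  rewrite ler_pdivrMr ?ltr0n// mulrC mulrA mulr1 ler_pdivlMr// mulrC.
  exact: hd.
have dot0 (x y : {ffun 'I_K * 'I_d -> bool}) :
    \sum_i (rademacher_mean R pi x i - 0) * (rademacher_mean R pi y i - 0) =
    overlap r (label_word pi) x y - 0.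
  by under eq_bigr do rewrite !subr0; rewrite subr0 dot_rademacher_mean.
have ok := oddness_le pi.
case.
(* Null reference, [c = 0], [e = k]: the weight condition holds for every frequency. *)
- move=> [even0 hn [A solves]].
  have ek : (k <= k.*2)%N by rewrite -addnn leq_addr.
  apply: (queries_ge d1 tau0 C00 hp N0 hn).
  apply: (testing_bound d1 n0 _ ek (lexx 0) tau0 tau1 dot0 _ erefl solves) => //.
  by move=> S; right; rewrite leq_addr.
(* Centring at the prior mean removes the empty frequency; the others in the support have weight at
   least 2, so [e = k + 2]. *)
- move=> [even0 hn [A solves]].
  have ek : (k + 2 <= k.*2)%N by rewrite -addnn leq_add2l.
  have hn2 : n%:R <= C0 * d%:R `^ ((k + 2)%:R / 2 - eps) by rewrite (natrD R k 2).
  apply: (queries_ge d1 tau0 C00 hp N0 hn2).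
  apply: (estimation_bound d1 n0 _ ek (mean_overlap_ge0 R d pi) tau0 tau1
    (dot_centered R pi) _ solves small) => // S.
  have [->|Sn0] := eqVneq S (zerov _); first by left; rewrite mulr1.
  have [->|cn0] := eqVneq (block_coef r (label_word pi) S) 0.
    by left; rewrite mulr0.
  by right; rewrite leq_add2l (even_weight_ge2 even0 cn0).
(* Positive oddness makes the empty coefficient vanish, so the null reference serves both
   problems. *)
move=> [one_odd hn solves].
have ek : (k + oddness pi <= k.*2)%N by rewrite -addnn leq_add2l.
have coefE (S : {ffun 'I_K * 'I_d -> bool}) :
    block_coef r (label_word pi) S <= 0 * (S == zerov _)%:R \/
    (k + oddness pi <= k + weight S)%N.
  have [->|cn0] := eqVneq (block_coef r (label_word pi) S) 0.
    by left; rewrite mul0r.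
  by right; rewrite leq_add2l (oddness_le_weight cn0).
rewrite -(natrD R k) in hn; apply: (queries_ge d1 tau0 C00 hp N0 hn).
case: solves => -[A solves].
  exact: (testing_bound d1 n0 _ ek (lexx 0) tau0 tau1 dot0 coefE erefl solves).
exact: (estimation_bound d1 n0 _ ek (lexx 0) tau0 tau1 dot0 coefE solves small).
Qed.
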